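(* There exists an absolute constant $C>0$ such that the following holds. Let $F_q$ be a finite field of odd characteristic with $q$ elements, and let $A\subset F_q$ satisfy $|A|\geq C q^{5/6}$. Then there exist $x,y\in F_q$ with $y\neq 0$ such that $x\in A$, $x+y\in A$ and $x+y^2\in A$.
   Context: $q=p^s$ for an odd prime $p$ and an integer $s\geq 1$. *)

(* Defs.v *)
From mathcomp Require Import all_boot all_algebra all_field.
From Stdlib Require Import Reals.

(* Main.v *)
(* Let q = #|F|, a = #|A| and let R(z) be the number of (p, u) in A x A with
   p + (u - p)^2 = z. If A contains no pattern, then R <= 1 on A, although the
   mean of R is a^2 / q; so the variance of R, i.e. the excess of the energy
   #{p + (u - p)^2 = p' + (u' - p')^2} over a^4 / q, is at least of order
   a * (a^2 / q)^2. In the coordinates X = u - u', Y = u + u', d = p - p',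
   s = p + p' the energy equation is (X - d)(Y - s) = - d, a relation that only
   depends on X / d and Y - s: it is a Cayley graph on the abelian group
   F^* x F, whose eigenvalues are the sums
     sum_z chi((z + 1) / z) psi(z).
   These being at most 2 sqrt q, the excess is O(sqrt q * a^2), which forces
   a = O(q^(5/6)).

   For the eigenvalue bound, let S_n be the sum over the extension of degree n
   of F (characters composed with norm and trace). Counting quadratic
   polynomials by their roots gives S_1^2 + S_2 = 2 psi(-1) q, so that
   |S_1| >= (2 + eps) sqrt q implies |S_2| >= (2 + 4 eps) q. Along the tower of
   quadratic extensions this contradicts |S_n| = O(q^(n/2)), with a constant
   depending on q, which follows from Stepanov's method applied to the points z
   with prescribed norm of (z + 1) / z and prescribed trace of z. *)
Require Import Defs.
From mathcomp Require Import all_boot all_order all_fingroup all_algebra all_solvable all_field all_character.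
From mathcomp Require Import zify ring.
Set Implicit Arguments.
Unset Strict Implicit.
Unset Printing Implicit Defensive.
Import Order.TTheory GRing.Theory Num.Theory.
Local Open Scope ring_scope.

(** * Stepanov's auxiliary polynomial *)

(** Modulo [A] only [P 0 * B ^+ m] survives and [B] is invertible, so [A] divides [P 0], which is
    too small. Dividing by [A] gives the induction. *)
Lemma coprime_expansion_eq0 (K : fieldType) (A B : {poly K}) m
    (P : nat -> {poly K}) :
    A != 0 -> coprimep A B -> (forall i, (i <= m)%N -> (size (P i) < size A)%N) ->
    \sum_(i < m.+1) P i * A ^+ i * B ^+ (m - i) = 0 ->
  forall i, (i <= m)%N -> P i = 0.
Proof.
move=> A0 coAB; elim: m P => [|m IHm] P szP.
  rewrite big_ord1 !expr0 !mulr1 => P0 i; rewrite leqn0 => /eqP ->; exact: P0.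
rewrite big_ord_recl expr0 mulr1 subn0.
have ->: \sum_(i < m.+1) P (lift ord0 i) * A ^+ lift ord0 i * B ^+ (m.+1 - lift ord0 i)
  = A * \sum_(i < m.+1) P i.+1 * A ^+ i * B ^+ (m - i).
  rewrite mulr_sumr; apply: eq_bigr => i _.
  by rewrite /= /bump add1n exprS subSS; ring.
move=> sum0.
have P00 : P 0%N = 0.
  apply/eqP; apply: contraTT (szP 0%N isT) => P0; rewrite -leqNgt dvdp_leq //.
  rewrite -(Gauss_dvdpl _ (coprimep_expr m.+1 coAB)).
  by move/eqP: sum0; rewrite addr_eq0 => /eqP ->; rewrite dvdpNr dvdp_mulIl.
move: sum0; rewrite P00 mul0r add0r => /eqP; rewrite mulf_eq0 (negPf A0) /= => /eqP sum0.
case=> [|i] //; rewrite ltnS; apply: (IHm (fun i => P i.+1)) => // j lejm.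
exact: szP.
Qed.

(** The leading coefficient of the largest nonzero term has nothing to cancel against. *)
Lemma sum_distinct_size_eq0 (R : nzRingType) (I : finType) (f : I -> {poly R}) :
    (forall i j, f i != 0 -> f j != 0 -> size (f i) = size (f j) -> i = j) ->
  \sum_i f i = 0 -> forall i, f i = 0.
Proof.
move=> finj sum0 i0; apply/eqP; case: (boolP (f i0 == 0)) => // fi0.
case: (@arg_maxnP _ i0 (fun i => f i != 0) (fun i => size (f i)) fi0) => i nzi maxi.
have := congr1 (fun p : {poly R} => p`_(size (f i)).-1) sum0.
rewrite coef_sum (bigD1 i) //= big1 ?addr0 => [|j neqji].
  by rewrite coef0 => /eqP; rewrite -lead_coefE lead_coef_eq0 (negPf nzi).
have [-> | nzj] := eqVneq (f j) 0; first exact: coef0.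
have: (size (f j) < size (f i))%N.
  rewrite ltn_neqAle (maxi j nzj : (_ <= _)%N) andbT; apply: contra neqji => /eqP eqs.
  by rewrite (finj j i).
move=> lts; apply: nth_default; move: lts.
by move: nzi; rewrite -size_poly_gt0; case: (size (f i)).
Qed.

Lemma pnat_pchar_poly (R : nzRingType) q r :
  [pchar R].-nat q -> [pchar {poly R}].-nat (q ^ r)%N.
Proof.
move=> Rq; rewrite pnatX; apply/orP; left; apply: sub_in_pnat Rq => p _.
by rewrite pchar_poly.
Qed.

Section Nonvanishing.

Variables (L : fieldType) (q : nat).
Hypothesis Lq : [pchar L].-nat q.

(** Exponent of the norm from the field with [q ^ r] elements to its subfield with [q] elements. *)
Definition repunit r := (\sum_(i < r) q ^ i)%N.

Lemma repunitS r : repunit r.+1 = (repunit r + q ^ r)%N.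
Proof. by rewrite /repunit big_ord_recr. Qed.

Lemma repunit_geom r : ((q.-1) * repunit r)%N = (q ^ r).-1.
Proof. by rewrite /repunit predn_exp. Qed.

(** A polynomial in the norm of [('X + 1) / 'X] with coefficients [P i], cleared of denominators. *)
Definition homog_window m r (P : nat -> {poly L}) : {poly L} :=
  \sum_(i < m.+1) P i * ('X + 1) ^+ (i * repunit r) * 'X ^+ ((m - i) * repunit r).

Lemma size_X1 k : size (('X + 1 : {poly L}) ^+ k) = k.+1.
Proof. by have := size_exp_XsubC k (-1 : L); rewrite polyCN opprK. Qed.

Lemma homog_window_eq0 m r (P : nat -> {poly L}) :
    (forall i, (i <= m)%N -> (size (P i) <= repunit r)%N) ->
  homog_window m r P = 0 -> forall i, (i <= m)%N -> P i = 0.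
Proof.
move=> szP W0; apply: (@coprime_expansion_eq0 _ (('X + 1) ^+ repunit r) ('X ^+ repunit r)).
- by rewrite -size_poly_gt0 size_X1.
- apply/coprimep_expl/coprimep_expr; rewrite coprimep_sym.
  by have := coprimep_XsubC 'X (-1 : L); rewrite polyCN opprK /root hornerX oppr_eq0 oner_eq0.
- by move=> i lim; rewrite size_X1 ltnS szP.
- rewrite -[RHS]W0; apply: eq_bigr => i _.
  by rewrite -!exprM ![(repunit r * _)%N]mulnC.
Qed.

(* As [repunit r.+1 = repunit r + q ^ r], Frobenius shows that, up to terms of
   degree below [m * q ^ r], the polynomial for [r.+1] is the one for [r]
   shifted by ['X ^ (m * q ^ r)]. *)
Lemma size_homog_window m r (P : nat -> {poly L}) : (1 < q)%N -> m = q.-2 ->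
    (forall i, (i <= m)%N -> (size (P i) <= repunit r)%N) ->
    (exists2 i, (i <= m)%N & P i != 0) ->
  (m * q ^ r < size (homog_window m r.+1 P) <= m.+1 * q ^ r)%N.
Proof.
move=> q_gt1 mq szP [i0 lei0m Pi0].
have geom := repunit_geom r; set E := (q ^ r)%N in geom *; set e := repunit r in szP geom *.
have E_gt0: (0 < E)%N by rewrite expn_gt0; case: (q) q_gt1.
have eE: (m.+1 * e = E.-1)%N by rewrite -geom mq; congr (_ * _)%N; case: (q) q_gt1 => [|[]].
set V := homog_window m r P.
have V0: V != 0.
  by apply: contraNneq Pi0 => /homog_window_eq0 P0; rewrite P0.
have szV: (size V <= E.-1)%N.
  apply: (leq_trans (size_sum _ _ _)); apply/bigmax_leqP => i _.
  rewrite -/e -mulrA; apply: (leq_trans (size_polyMleq _ _)).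
  have := size_polyMleq (('X + 1 : {poly L}) ^+ (i * e)) ('X^((m - i) * e)).
  rewrite size_X1 size_polyXn -eE => sz2.
  have lei: (i <= m)%N by rewrite -ltnS.
  have := szP i lei.
  have: (i * e + (m - i) * e = m * e)%N by rewrite -mulnDl subnKC.
  by move: sz2; rewrite mulSn; lia.
(* [Low] collects all terms of the binomial expansion of [('X^E + 1) ^+ i] except the top one; the
   top ones add up to [V * 'X^(m * E)]. *)
pose Low : {poly L} := \sum_(i < m.+1) P i * ('X + 1) ^+ (i * e) * 'X ^+ ((m - i) * e)
   * (\sum_(l < i) ('X^(l * E) *+ 'C(i, l))) * 'X^((m - i) * E).
have defW: homog_window m r.+1 P = Low + V * 'X^(m * E).
  rewrite /V /homog_window mulr_suml -big_split; apply: eq_bigr => i _ /=.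
  have lei: (i <= m)%N by rewrite -ltnS.
  rewrite repunitS -/e -/E !mulnDr !exprD.
  have -> : (('X + 1) ^+ (i * E) : {poly L}) = \sum_(l < i.+1) 'X^(l * E) *+ 'C(i, l).
    rewrite mulnC exprM (exprDn_pchar _ _ (pnat_pchar_poly r Lq)) expr1n addrC exprDn.
    by apply: eq_bigr => l _; rewrite expr1n mul1r -exprM mulnC; congr (_ *+ _).
  have -> : ('X^(m * E) : {poly L}) = 'X^(i * E) * 'X^((m - i) * E).
    by rewrite -exprD -mulnDl subnKC.
  rewrite big_ord_recr /= binn.
  by ring.
have szLow: (size Low <= m * E)%N.
  apply: (leq_trans (size_sum _ _ _)); apply/bigmax_leqP => i _.
  have lei: (i <= m)%N by rewrite -ltnS.
  have := szP i lei.
  case: (nat_of_ord i) lei => [|i'] lei szPi.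
    by rewrite big_ord0 mulr0 mul0r size_poly0.
  set S := \sum_(l < _) _.
  have szS: (size S <= (i' * E).+1)%N.
    apply: (leq_trans (size_sum _ _ _)); apply/bigmax_leqP => l _.
    rewrite -scaler_nat; apply: (leq_trans (size_scale_leq _ _)).
    by rewrite size_polyXn ltnS leq_mul2r -ltnS ltn_ord orbT.
  case: (posnP (size (P i'.+1))) => [/eqP|szPi0].
    by rewrite size_poly_eq0 => /eqP ->; rewrite !mul0r size_poly0.
  have s1 := size_polyMleq (P i'.+1) (('X + 1) ^+ (i'.+1 * e)).
  set A1 := P i'.+1 * _ in s1 *.
  have s2 := size_polyMleq A1 ('X^((m - i'.+1) * e)); set A2 := A1 * _ in s2 *.
  have s3 := size_polyMleq A2 S; set A3 := A2 * _ in s3 *.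
  have s4 := size_polyMleq A3 ('X^((m - i'.+1) * E)).
  apply: (leq_trans s4).
  rewrite size_polyXn; rewrite size_polyXn in s2; rewrite size_X1 in s1; clear s4.
  have h1: (i'.+1 * e + (m - i'.+1) * e = m * e)%N by rewrite -mulnDl subnKC.
  have h2: (i' * E + (m - i'.+1) * E + E = m * E)%N by rewrite -[in RHS](subnKC lei) mulnDl mulSn; lia.
  move: eE; rewrite mulSn. lia.
move: V0; rewrite -size_poly_gt0 => V0.
have szVX: size (V * 'X^(m * E)) = (m * E + size V)%N.
  by rewrite size_mulXn // -size_poly_gt0.
rewrite defW addrC size_polyDl szVX; first by rewrite mulSn; lia.
by rewrite (leq_ltn_trans szLow) //; lia.
Qed.

End Nonvanishing.

Section Auxiliary.

Variables (L : fieldType) (q : nat).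
Hypotheses (Lq : [pchar L].-nat q) (q_gt1 : (1 < q)%N).

(** The trace from the field with [q ^ r] elements to its subfield with [q] elements. *)
Definition trpoly r : {poly L} := \sum_(i < r) 'X^(q ^ i).

Lemma size_trpoly r : size (trpoly r.+1) = (q ^ r).+1 /\ trpoly r.+1 \is monic.
Proof.
have szX : size (trpoly r.+1) = (q ^ r).+1 /\ lead_coef (trpoly r.+1) = 1.
  rewrite /trpoly big_ord_recr /= addrC.
  have lt: (size (\sum_(i < r) 'X^(q ^ i) : {poly L})%R
     < size ('X^(q ^ r) : {poly L})%R)%N.
    rewrite size_polyXn ltnS; apply: (leq_trans (size_sum _ _ _)).
    by apply/bigmax_leqP => i _; rewrite size_polyXn ltn_exp2l.
  by rewrite size_polyDl // lead_coefDl // size_polyXn lead_coefXn.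
by case: szX => -> /eqP.
Qed.

(* Up to a common power of ['X], the polynomial
   [\sum P_(j,k,i)(z) ((z + 1) / z) ^ (i e) tr(z) ^ j z ^ (k q^(r+1))]
   with [e = (q^(r+1) - 1) / (q - 1)]. *)
Definition auxpoly m r K (P : nat -> nat -> nat -> {poly L}) : {poly L} :=
  \sum_(jk : 'I_q * 'I_K)
    homog_window q m r.+1 (P jk.1 jk.2) * trpoly r.+1 ^+ jk.1 * 'X^(jk.2 * q ^ r.+1).

(** The size of a nonzero [homog_window] lies in a half-open interval of length [q ^ r], which the
    other two factors shift by [(j + k * q) * q ^ r]. As [j < q], distinct pairs have disjoint
    intervals, so no cancellation occurs. *)
Lemma auxpoly_eq0 r K (P : nat -> nat -> nat -> {poly L}) :
    (forall j k i, (size (P j k i) <= repunit q r)%N) ->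
    auxpoly q.-2 r K P = 0 ->
  forall i j k, (i <= q.-2)%N -> (j < q)%N -> (k < K)%N -> P j k i = 0.
Proof.
move=> szP aux0 i j k lei ltj ltk.
have E_gt0: (0 < q ^ r)%N by rewrite expn_gt0; case: (q) q_gt1.
set m := q.-2 in lei aux0.
have [szt mont] := size_trpoly r.
pose W (jk : 'I_q * 'I_K) := homog_window q m r.+1 (P jk.1 jk.2).
have szT jk: W jk != 0 -> size (W jk * trpoly r.+1 ^+ jk.1 * 'X^(jk.2 * q ^ r.+1))
   = (size (W jk) + (jk.1 + jk.2 * q) * q ^ r)%N.
  move=> Wn0; rewrite -mulrA size_Mmonic ?monicMl ?monicXn ?monic_exp //.
  rewrite size_monicM ?monic_exp ?monic_neq0 ?monicXn // size_polyXn.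
  have -> : size (trpoly r.+1 ^+ jk.1) = (jk.1 * q ^ r).+1.
    have := size_exp (trpoly r.+1) jk.1.
    rewrite szt /= mulnC => <-; rewrite prednK // size_poly_gt0.
    by rewrite monic_neq0 ?monic_exp.
  by rewrite expnS mulnDl mulnA; lia.
have winW jk : W jk != 0 -> (m * q ^ r < size (W jk) <= m.+1 * q ^ r)%N.
  move=> Wn0; apply: size_homog_window => //.
  case: (pickP (fun l : 'I_m.+1 => P jk.1 jk.2 l != 0)) => [l Pl | P0].
    by exists l; rewrite // -ltnS.
  case/eqP: Wn0; rewrite /W /homog_window big1 // => l _.
  by have /negbFE/eqP -> := P0 l; rewrite !mul0r.
have W0 jk : W jk = 0.
  have t0: forall jk, W jk * trpoly r.+1 ^+ jk.1 * 'X^(jk.2 * q ^ r.+1) = 0.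
    apply: sum_distinct_size_eq0 aux0 => jk1 jk2.
    rewrite !mulf_eq0 !negb_or => /andP[/andP[W1 _] _] /andP[/andP[W2 _] _].
    rewrite !szT // => eqs.
    have /andP[a1 b1] := winW _ W1; have /andP[a2 b2] := winW _ W2.
    have eqjk: (jk1.1 + jk1.2 * q = jk2.1 + jk2.2 * q)%N.
      move: eqs a1 b1 a2 b2; rewrite mulSn.
      move: (jk1.1 + _)%N (jk2.1 + _)%N => u v eqs a1 b1 a2 b2.
      case: (ltngtP u v) => // lt.
        by have := leq_mul lt (leqnn (q ^ r)%N); rewrite mulSn; lia.
      by have := leq_mul lt (leqnn (q ^ r)%N); rewrite mulSn; lia.
    case: jk1 jk2 eqjk {W1 W2 eqs a1 b1 a2 b2} => [j1 k1] [j2 k2] /= eqjk.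
    have eqj : j1 = j2 :> nat.
      by have := congr1 (modn^~ q) eqjk; rewrite ![(_ + _ * q)%N]addnC !modnMDl !modn_small.
    have eqk : k1 = k2 :> nat.
      by move/eqP: eqjk; rewrite eqj eqn_add2l eqn_pmul2r ?(ltnW q_gt1) // => /eqP.
    by congr (_, _); apply: val_inj.
  have := t0 jk; move/eqP; rewrite !mulf_eq0.
  rewrite [_ ^+ _ == 0]negbTE ?monic_neq0 ?monic_exp //.
  by rewrite [_ ^+ _ == 0]negbTE ?monic_neq0 ?monicXn // !orbF => /eqP.
apply: (homog_window_eq0 _ (W0 (Ordinal ltj, Ordinal ltk)) lei) => i' _ /=.
by rewrite repunitS (leq_trans (szP _ _ _)) // leq_addr.
Qed.

Lemma size_auxpoly r K (P : nat -> nat -> nat -> {poly L}) :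
    (forall j k i, (size (P j k i) <= repunit q r)%N) ->
  (size (auxpoly q.-2 r K P) <= K.+1 * q ^ r.+1)%N.
Proof.
move=> szP; have [szt mont] := size_trpoly r.
apply: (leq_trans (size_sum _ _ _)); apply/bigmax_leqP => [[j k]] _ /=.
set W := homog_window _ _ _ _.
case: (eqVneq W 0) => [-> | Wn0]; first by rewrite !mul0r size_poly0.
have szW : (size W <= q.-2.+1 * q ^ r)%N.
  suff /andP[]: (q.-2 * q ^ r < size W <= q.-2.+1 * q ^ r)%N by [].
  apply: size_homog_window => //.
  case: (pickP (fun l : 'I_q.-2.+1 => P j k l != 0)) => [l Pl | P0].
    by exists l; rewrite // -ltnS.
  case/eqP: Wn0; rewrite /W /homog_window big1 // => l _.
  by have /negbFE/eqP -> := P0 l; rewrite !mul0r.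
have s1 := size_polyMleq (W * trpoly r.+1 ^+ j) ('X^(k * q ^ r.+1)).
have s2 := size_polyMleq W (trpoly r.+1 ^+ j).
have s3 := size_poly_exp_leq (trpoly r.+1) j.
apply: (leq_trans s1); rewrite size_polyXn addnS /=.
have hj : (j * q ^ r <= q.-1 * q ^ r)%N.
  by rewrite leq_mul2r -ltnS prednK ?ltn_ord ?orbT // ltnW.
have hk : (k.+1 * q ^ r.+1 <= K * q ^ r.+1)%N by rewrite leq_mul2r ltn_ord orbT.
have hq : (q.-2.+1 * q ^ r + q.-1 * q ^ r <= 2 * q ^ r.+1)%N.
  by rewrite -mulnDl expnS mulnA leq_mul2r; apply/orP; right; lia.
move: s3 hk szW s2 hj hq; rewrite szt /= [(_ * j)%N]mulnC.
rewrite [(k.+1 * _)%N]mulSn [(K.+1 * _)%N]mulSn.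
move: (q.-2.+1 * _)%N (q.-1 * _)%N (q ^ r.+1)%N (j * _)%N => a b Q d.
by move: (k * Q)%N (K * Q)%N => u v; lia.
Qed.

End Auxiliary.

(** * Local expansions and vanishing *)

Lemma linear_relation (K : fieldType) (I J : finType) (a : I -> J -> K) :
    (#|J| < #|I|)%N ->
  exists2 c : I -> K, (exists i, c i != 0) & forall j, \sum_i c i * a i j = 0.
Proof.
move=> ltJI.
pose A := \matrix_(i < #|I|, j < #|J|) a (enum_val i) (enum_val j).
have: kermx A != 0.
  by rewrite kermx_eq0 -row_leq_rank -ltnNge (leq_ltn_trans (rank_leq_col A)).
case/rowV0Pn => v /sub_kermxP vA v0.
exists (fun i => v 0 (enum_rank i)).
  have /rV0Pn[i vi] := v0; exists (enum_val i); by rewrite enum_valK.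
move=> j; transitivity ((v *m A) 0 (enum_rank j)); last by rewrite vA mxE.
rewrite mxE (reindex_onto enum_rank enum_val) => [|i _]; last exact: enum_valK.
apply: eq_big => [i | i _]; first by rewrite enum_rankK eqxx.
by rewrite mxE !enum_rankK.
Qed.

Section WeightedDegree.

Variable L : fieldType.
Implicit Types b c : {poly {poly L}}.

(* The outer variable has weight 2, the inner one weight 1. *)
Definition wdeg_le (n : nat) b := forall l, (size (b`_l)%R <= (n + l.*2).+1)%N.

Lemma wdeg_leC (p : {poly L}) n : (size p <= n.+1)%N -> wdeg_le n p%:P.
Proof.
move=> szp l; rewrite coefC; case: eqP => [-> | _]; last by rewrite size_poly0.
by rewrite addn0.
Qed.

Lemma wdeg_leD n b c : wdeg_le n b -> wdeg_le n c -> wdeg_le n (b + c).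
Proof.
by move=> wb wc l; rewrite coefD (leq_trans (size_polyD _ _)) // geq_max wb wc.
Qed.

Lemma wdeg_le_sum n (I : finType) (f : I -> {poly {poly L}}) :
  (forall i, wdeg_le n (f i)) -> wdeg_le n (\sum_i f i).
Proof.
move=> wf l; rewrite coef_sum; apply: (leq_trans (size_sum _ _ _)).
by apply/bigmax_leqP => i _; apply: wf.
Qed.

Lemma wdeg_leM n m b c : wdeg_le n b -> wdeg_le m c -> wdeg_le (n + m) (b * c).
Proof.
move=> wb wc l; rewrite coefM; apply: (leq_trans (size_sum _ _ _)).
apply/bigmax_leqP => i _; apply: (leq_trans (size_polyMleq _ _)).
by have := wb i; have := wc (l - i)%N; have := ltn_ord i; lia.
Qed.

Lemma wdeg_leX n b k : wdeg_le n b -> wdeg_le (n * k) (b ^+ k).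
Proof.
move=> wb; elim: k => [|k IHk].
  by rewrite muln0 expr0 -polyC1; apply: wdeg_leC; rewrite size_poly1.
by rewrite exprS mulnS; apply: wdeg_leM.
Qed.

Lemma wdeg_leCX (p : {poly L}) n : (size p <= n.+3)%N -> wdeg_le n (p%:P * 'X).
Proof.
move=> szp [|[|l]]; rewrite coefMX ?size_poly0 //= coefC /= ?size_poly0 //.
by rewrite addn2.
Qed.

End WeightedDegree.

Section Stepanov.

Variables (L : finFieldType) (q r : nat).
Hypotheses (Lq : [pchar L].-nat q) (q_gt1 : (1 < q)%N).
Hypothesis cardL : #|L| = (q ^ r.+1)%N.
Variables al be : L.

Let Q := (q ^ r.+1)%N.
Let e := repunit q r.+1.
Let m := q.-2.

Definition stepanov_fiber : {set L} :=
  [set z | [&& z != 0, z + 1 != 0, ((z + 1) / z) ^+ e == al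
             & (trpoly L q r.+1).[z] == be]].

(* The substitution [z + z (z + 1) S]; the factor [z (z + 1)] keeps the local
   expansions of [z + 1] and [z] polynomial. *)
Let zz : {poly {poly L}} := ('X)%:P.
Let step : {poly {poly L}} := ('X * ('X + 1))%:P * 'X.

(** The expansion of [monomial] at a point [z] of the fiber, modulo ['X^Q] and up to the factor
    [z ^+ (m * e)], with the point kept as inner variable. Here [z + 1] and [z] become
    [(z + 1) * (1 + z * 'X)] and [z * (1 + (z + 1) * 'X)], norm and trace at the point become the
    constants [al] and [be], and [z ^+ (k * Q)] becomes [z ^+ k]. *)
Definition local_monomial (i j k d : nat) : {poly {poly L}} :=
  (zz + step) ^+ d * ((al ^+ i)%:P)%:P * (1 + zz * 'X) ^+ (i * e)
  * (1 + (zz + 1) * 'X) ^+ ((m - i) * e)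
  * ((be%:P)%:P + \sum_(l < r.+1) step ^+ (q ^ l)) ^+ j * zz ^+ k.

(** Once norm and trace are constants, only the factors with exponents [d] and [k] have positive
    weight. This low degree in the point is the gain of Stepanov's method. *)
Lemma wdeg_local_monomial i j k d : wdeg_le (d + k) (local_monomial i j k d).
Proof.
have szX1 : size ('X + 1 : {poly L}) = 2%N.
  by have := size_XsubC (-1 : L); rewrite polyCN opprK.
have w1 : wdeg_le 0 (1 : {poly {poly L}}).
  by rewrite -polyC1; apply: wdeg_leC; rewrite size_poly1.
have wstep : wdeg_le 0 step.
  apply: wdeg_leCX; rewrite (leq_trans (size_polyMleq _ _)) //.
  by rewrite szX1 size_polyX.
have wz : wdeg_le 1 zz by apply: wdeg_leC; rewrite size_polyX.
rewrite /local_monomial.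
have -> : (d + k = 1 * d + 0 + 0 * (i * e) + 0 * ((m - i) * e) + 0 * j + 1 * k)%N.
  by lia.
apply: wdeg_leM; last exact: wdeg_leX.
apply: wdeg_leM; last first.
  apply/wdeg_leX/wdeg_leD; first by apply: wdeg_leC; rewrite size_polyC; case: eqP.
  by apply: wdeg_le_sum => l; rewrite -[0%N](mul0n (q ^ l)%N); apply: wdeg_leX.
apply: wdeg_leM; last first.
  by apply/wdeg_leX/wdeg_leD => //; rewrite /zz -polyC1 -polyCD; apply: wdeg_leCX; rewrite szX1.
apply: wdeg_leM; last first.
  by apply/wdeg_leX/wdeg_leD => //; apply: wdeg_leCX; rewrite size_polyX.
apply: wdeg_leM; last by apply: wdeg_leC; rewrite size_polyC; case: eqP.
apply/wdeg_leX/wdeg_leD => //.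
by move=> l; apply: (leq_trans (wstep l)); lia.
Qed.

Definition monomial (i j k d : nat) : {poly L} :=
  'X^d * ('X + 1) ^+ (i * e) * 'X ^+ ((m - i) * e)
  * trpoly L q r.+1 ^+ j * 'X^(k * Q).

Lemma trpolyD (a b : {poly L}) :
  trpoly L q r.+1 \Po (a + b)
  = (trpoly L q r.+1 \Po a) + (trpoly L q r.+1 \Po b).
Proof.
rewrite /trpoly !raddf_sum /= -big_split; apply: eq_bigr => l _ /=.
by rewrite !comp_Xn_poly exprDn_pchar // pnat_pchar_poly.
Qed.

(** By Frobenius the trace is additive, and the [Q]-th power of [z + z * (z + 1) * 'X] is [z] modulo
    ['X^Q], since [z ^+ Q = z]. The norm condition handles the remaining large powers. *)
Lemma local_expansion z i j k d : z \in stepanov_fiber -> (i <= m)%N ->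
  exists u, monomial i j k d \Po (z%:P + (z * (z + 1))%:P * 'X)
    = (z ^+ (m * e))%:P * map_poly (horner_eval z) (local_monomial i j k d)
      + u * 'X^Q.
Proof.
rewrite inE => /and4P[z0 z1 /eqP zal /eqP zbe] leim.
set s := _ + _ * _.
pose w := (z * (z + 1))%:P * 'X : {poly L}.
have sw : s = z%:P + w by [].
have evz : map_poly (horner_eval z) zz = z%:P.
  by rewrite map_polyC /= /horner_eval hornerX.
have evw : map_poly (horner_eval z) step = w.
  by rewrite rmorphM /= map_polyC map_polyX /= /horner_eval !hornerE.
pose f := ('X^d * ('X + 1) ^+ (i * e) * 'X ^+ ((m - i) * e)
  * trpoly L q r.+1 ^+ j : {poly L}) \Po s.
have X1s : ('X + 1) \Po s = (z + 1)%:P * (1 + z%:P * 'X).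
  rewrite comp_polyD comp_polyX -polyC1 comp_polyC /s polyCM !polyCD polyC1.
  by ring.
have Xs : s = z%:P * (1 + (z + 1)%:P * 'X) by rewrite /s polyCM; ring.
have ts : trpoly L q r.+1 \Po s = be%:P + \sum_(l < r.+1) w ^+ (q ^ l).
  rewrite sw trpolyD comp_polyCr zbe; congr (_ + _).
  rewrite /trpoly raddf_sum /=; apply: eq_bigr => l _; exact: comp_Xn_poly.
have zpow : (z + 1) ^+ (i * e) * z ^+ ((m - i) * e) = z ^+ (m * e) * al ^+ i.
  rewrite -{2}(subnKC leim) mulnDl exprD -zal [(i * e)%N]mulnC !exprM expr_div_n.
  rewrite -[in RHS]exprM expr_div_n mulrAC -!exprM; field.
  by rewrite expf_neq0.
have ef : f = (z ^+ (m * e))%:P * (s ^+ d * (al ^+ i)%:P * (1 + z%:P * 'X) ^+ (i * e)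
  * (1 + (z%:P + 1) * 'X) ^+ ((m - i) * e)
  * (be%:P + \sum_(l < r.+1) w ^+ (q ^ l)) ^+ j).
  rewrite /f !comp_polyM !rmorphXn /= X1s ts comp_polyX -polyCD.
  rewrite {2}Xs !exprMn -!polyC_exp.
  rewrite [RHS](_ : _ = (z ^+ (m * e))%:P * (al ^+ i)%:P
    * (s ^+ d * (1 + z%:P * 'X) ^+ (i * e) * (1 + (z + 1)%:P * 'X) ^+ ((m - i) * e)
       * (be%:P + \sum_(l < r.+1) w ^+ (q ^ l)) ^+ j)); last by ring.
  by rewrite -polyCM -zpow polyCM !polyC_exp; ring.
have [u eu] : exists u, s ^+ (k * Q) = z%:P ^+ k + u * 'X^Q.
  have sQ : s ^+ Q = z%:P + (z * (z + 1))%:P ^+ Q * 'X^Q.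
    rewrite sw (exprDn_pchar _ _ (pnat_pchar_poly r.+1 Lq)) exprMn; congr (_ + _).
    by rewrite -polyC_exp -cardL expf_card.
  rewrite mulnC exprM sQ; set c := _ ^+ Q.
  elim: (k) => [|k' [u IH]]; first by exists 0; rewrite !expr0 mul0r addr0.
  by exists (u * (z%:P + c * 'X^Q) + z%:P ^+ k' * c); rewrite exprSr IH exprSr; ring.
exists (f * u).
rewrite /monomial comp_polyM -/f comp_Xn_poly eu mulrDr mulrA; congr (_ + _).
rewrite ef -!mulrA; congr (_ * _).
move: evz evw; rewrite /local_monomial; generalize zz step => zz' step' evz evw.
rewrite !rmorphM !rmorphXn !rmorphD /= !rmorphM /= !rmorphD !rmorph1 /= evz evw.
rewrite !map_polyX !map_polyC rmorph_sum /=.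
under [in RHS]eq_bigr => l _ do rewrite rmorphXn /= evw.
rewrite /horner_eval !hornerC.
by rewrite -!mulrA.
Qed.

End Stepanov.

Lemma prod_XsubC_exp_dvd (K : fieldType) (R : {poly K}) M (s : seq K) :
    uniq s -> (forall z, z \in s -> ('X - z%:P) ^+ M %| R) ->
  \prod_(z <- s) ('X - z%:P) ^+ M %| R.
Proof.
elim: s => [|z s IHs] /=; first by rewrite big_nil dvd1p.
case/andP=> zs us dvdR; rewrite big_cons Gauss_dvdp; last first.
  rewrite big_seq; elim/big_ind: _ => [|p1 p2 co1 co2|y ys]; first exact: coprimep1.
    by rewrite coprimepMr co1.
  apply/coprimep_expl/coprimep_expr; rewrite coprimep_XsubC root_XsubC.
  by apply: contraNneq zs => <-.
rewrite dvdR ?mem_head // IHs // => y ys.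
by rewrite dvdR // in_cons ys orbT.
Qed.

Section StepanovBound.

Variables (L : finFieldType) (q r : nat).
Hypotheses (Lq : [pchar L].-nat q) (q_gt1 : (1 < q)%N).
Hypothesis cardL : #|L| = (q ^ r.+1)%N.
Variables al be : L.

Let m := q.-2.

(** The unknowns are the [q.-1 * q * K * D] coefficients of the [P j k i]. The equations ask for
    vanishing at [M] orders, each a polynomial in the point with at most [D + K + 2 * M]
    coefficients. A nonzero solution vanishes to order [M] on the whole fiber, and its degree bounds
    the fiber. *)
Lemma card_stepanov_fiber K M : (M <= q ^ r.+1)%N ->
    (M * (repunit q r + K + 2 * M) < q.-1 * q * K * repunit q r)%N ->
  (#|stepanov_fiber q r al be| * M <= K.+1 * q ^ r.+1)%N.
Proof.
set D := repunit q r; set Q := (q ^ r.+1)%N => leMQ ltMD.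
pose I : finType := ('I_m.+1 * ('I_q * 'I_K) * 'I_D)%type.
pose J : finType := ('I_M * 'I_(D + K + 2 * M))%type.
pose loc (x : I) := local_monomial q r al be x.1.1 x.1.2.1 x.1.2.2 x.2.
have ltJI : (#|J| < #|I|)%N.
  rewrite !card_prod !card_ord; apply: leq_trans ltMD _.
  by rewrite [m.+1]prednK ?mulnA // -ltnS prednK // ltnW.
have [c [x0 cx0] csum] := linear_relation (fun (x : I) (y : J) => (loc x)`_y.1`_y.2) ltJI.
pose P (j k i : nat) : {poly L} :=
  match (insub i : option 'I_m.+1), (insub j : option 'I_q), (insub k : option 'I_K) with
  | Some i', Some j', Some k' => \sum_(d < D) c (i', (j', k'), d) *: 'X^d
  | _, _, _ => 0
  end.
have PE (i : 'I_m.+1) (j : 'I_q) (k : 'I_K) :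
    P j k i = \sum_(d < D) c (i, (j, k), d) *: 'X^d.
  by rewrite /P !valK.
have szP j k i : (size (P j k i) <= D)%N.
  rewrite /P; case: insubP => [i' _ _|_]; last by rewrite size_poly0.
  case: insubP => [j' _ _|_]; last by rewrite size_poly0.
  case: insubP => [k' _ _|_]; last by rewrite size_poly0.
  apply: (leq_trans (size_sum _ _ _)); apply/bigmax_leqP => d _.
  by apply: (leq_trans (size_scale_leq _ _)); rewrite size_polyXn.
pose R := auxpoly q m r K P.
have R0 : R != 0.
  apply: contraNneq cx0 => /(auxpoly_eq0 Lq q_gt1 szP).
  case: x0 => [[i [j k]] d] /(_ i j k (ltn_ord i) (ltn_ord j) (ltn_ord k)).
  rewrite PE => /(congr1 (fun p : {poly L} => p`_d)).
  rewrite coef_sum coef0 (bigD1 d) //= big1 ?addr0 => [|d' ne].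
    by rewrite coefZ coefXn eqxx mulr1 => ->.
  by rewrite coefZ coefXn val_eqE eq_sym (negPf ne) mulr0.
have ER : R = \sum_(x : I) c x *: monomial L q r x.1.1 x.1.2.1 x.1.2.2 x.2.
  transitivity (\sum_(jk : 'I_q * 'I_K) \sum_(i < m.+1) \sum_(d < D)
      c (i, jk, d) *: monomial L q r i jk.1 jk.2 d); last first.
    by rewrite exchange_big pair_bigA /= pair_bigA /=; apply: eq_bigr => [[[i jk] d]].
  apply: eq_bigr => [[j k]] _ /=.
  rewrite /homog_window !mulr_suml; apply: eq_bigr => i _; rewrite PE.
  rewrite !mulr_suml; apply: eq_bigr => d _.
  by rewrite /monomial -!mul_polyC -!mulrA.
(* The local expansion of [R] with the point as a variable: killing its low orders serves all points
   of the fiber at once. *)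
pose B := \sum_(x : I) ((c x)%:P)%:P * loc x.
have B0 l : (l < M)%N -> B`_l = 0.
  move=> ltl; apply/polyP => s; rewrite coef0.
  rewrite /B coef_sum; under eq_bigr => x _ do rewrite coefCM.
  rewrite coef_sum; under eq_bigr => x _ do rewrite coefCM.
  have [lts | les] := ltnP s (D + K + 2 * M).
    exact: (csum (Ordinal ltl, Ordinal lts)).
  (* Coefficients outside the range of the equations vanish by weighted degree. *)
  rewrite big1 // => x _; rewrite nth_default ?mulr0 //.
  have wd := wdeg_local_monomial Lq q_gt1 cardL al be x.1.1 x.1.2.1 x.1.2.2 x.2 l.
  apply: leq_trans wd (leq_trans _ les).
  by have := ltn_ord x.1.2.2; have := ltn_ord x.2; lia.
have dvdR z : z \in stepanov_fiber q r al be -> ('X - z%:P) ^+ M %| R.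
  move=> zZ; set s := z%:P + (z * (z + 1))%:P * 'X.
  have /fin_all_exists[u uE] (x : I) := @local_expansion _ _ _ Lq cardL al be z
    x.1.1 x.1.2.1 x.1.2.2 x.2 zZ (ltn_ord x.1.1).
  have evM (p : {poly L}) b : map_poly (horner_eval z) (p%:P * b)
      = p.[z]%:P * map_poly (horner_eval z) b.
    by rewrite rmorphM /= map_polyC.
  have Rs : R \Po s = (z ^+ (m * repunit q r.+1))%:P * map_poly (horner_eval z) B
      + (\sum_x (c x)%:P * u x) * 'X^Q.
    rewrite ER raddf_sum /= /B raddf_sum /= mulr_sumr mulr_suml -big_split /=.
    apply: eq_bigr => x _; rewrite comp_polyZ uE -/(loc x) -mul_polyC evM hornerC.
    by ring.
  have [h Rh] : exists h, R \Po s = h * 'X^M.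
    exists ((z ^+ (m * repunit q r.+1))%:P * drop_poly M (map_poly (horner_eval z) B)
      + (\sum_x (c x)%:P * u x) * 'X^(Q - M)).
    rewrite Rs mulrDl -!mulrA -exprD subnK //; congr (_ * _ + _).
    rewrite -[LHS](poly_take_drop M) [take_poly _ _](_ : _ = 0) ?add0r //.
    apply/polyP => l; rewrite coef_take_poly coef0; case: ifP => // ltl.
    by rewrite coef_map B0 // raddf0.
  move: zZ; rewrite inE => /and4P[z0 z1 _ _].
  (* The inverse of the substitution [s], available because [z] and [z + 1] are nonzero. *)
  pose s' := (z * (z + 1))^-1%:P * ('X - z%:P).
  have ss' : s \Po s' = 'X.
    rewrite /s comp_polyD comp_polyM !comp_polyC comp_polyX /s' mulrA -polyCM.
    by rewrite mulfV ?mulf_neq0 // mul1r addrC subrK.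
  have -> : R = (R \Po s) \Po s' by rewrite -comp_polyA ss' comp_polyXr.
  rewrite Rh comp_polyM comp_Xn_poly /s' exprMn mulrA.
  exact: dvdp_mulIr.
have /dvdp_leq -/(_ R0) : \prod_(z <- enum (stepanov_fiber q r al be)) ('X - z%:P) ^+ M %| R.
  apply: prod_XsubC_exp_dvd; first exact: enum_uniq.
  by move=> z; rewrite mem_enum; apply: dvdR.
rewrite prodrXl; have := size_exp (\prod_(z <- enum (stepanov_fiber q r al be)) ('X - z%:P)) M.
rewrite size_prod_XsubC /= -cardE => <- szle.
by rewrite (leq_trans (leq_pred _)) // (leq_trans szle) // size_auxpoly.
Qed.

End StepanovBound.

(** * Kummer sums over a large extension *)

Definition mulchar (K : finFieldType) (chi : K -> algC) :=
  [/\ chi 0 = 0, chi 1 = 1 & {morph chi : x y / x * y}].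

Definition addchar (K : finFieldType) (psi : K -> algC) :=
  psi 0 = 1 /\ {morph psi : x y / x + y >-> x * y}.

(* At [z = 0] the junk value [(0 + 1) / 0 = 0] makes the summand vanish. *)
Definition kummer_sum (K : finFieldType) (chi psi : K -> algC) :=
  \sum_z chi ((z + 1) / z) * psi z.

Section Characters.

Variable K : finFieldType.
Implicit Types chi psi : K -> algC.

Lemma norm_root1 n (x : algC) : (0 < n)%N -> x ^+ n = 1 -> `|x| = 1.
Proof.
move=> n0 xn; have /eqP := congr1 Num.norm xn.
by rewrite normrX normr1 pexpr_eq1 // => /eqP.
Qed.

Lemma mulchar_exp chi x n : mulchar chi -> chi (x ^+ n) = chi x ^+ n.
Proof.
case=> _ c1 cM; elim: n => [|n IHn]; first by rewrite !expr0.
by rewrite !exprS cM IHn.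
Qed.

Lemma norm_mulchar chi x : mulchar chi -> x != 0 -> `|chi x| = 1.
Proof.
move=> mc x0; have [_ c1 _] := mc.
have gt1 := finNzRing_gt1 K; apply: (@norm_root1 #|K|.-1); first by rewrite -subn1 subn_gt0.
rewrite -mulchar_exp // (_ : _ ^+ _ = 1) //; apply: (mulfI x0).
by rewrite -exprS prednK ?expf_card ?mulr1 // ltnW.
Qed.

Lemma norm_addchar psi x : addchar psi -> `|psi x| = 1.
Proof.
case=> p0 pD; have [p p_pr pK] := finPcharP K.
apply: (@norm_root1 p); first exact: prime_gt0.
rewrite -p0 -(mulrn_pchar pK x); elim: (p) => [|n IHn]; first by rewrite expr0 mulr0n p0.
by rewrite exprS mulrS pD IHn.
Qed.

Lemma sum_mulchar chi : mulchar chi -> (exists2 x, x != 0 & chi x != 1) ->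
  \sum_x chi x = 0.
Proof.
move=> mc [a a0 ca]; have [c0 c1 cM] := mc.
have := erefl (\sum_x chi x); rewrite {1}(reindex_inj (mulfI a0)) /=.
under eq_bigr => x _ do rewrite cM.
rewrite -mulr_sumr => /eqP; rewrite -subr_eq0 -[X in _ - X]mul1r -mulrBl.
by rewrite mulf_eq0 subr_eq0 (negPf ca) => /eqP.
Qed.

Lemma sum_addchar psi : addchar psi -> (exists x, psi x != 1) -> \sum_x psi x = 0.
Proof.
move=> [p0 pD] [a pa].
have := erefl (\sum_x psi x); rewrite {1}(reindex_inj (addrI a)) /=.
under eq_bigr => x _ do rewrite pD.
rewrite -mulr_sumr => /eqP; rewrite -subr_eq0 -[X in _ - X]mul1r -mulrBl.
by rewrite mulf_eq0 subr_eq0 (negPf pa) => /eqP.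
Qed.

End Characters.

Lemma leq_card_fibers (T T' : finType) (A : {pred T}) (V : {pred T'}) (f : T -> T') k :
    {in A, forall x, f x \in V} -> (forall v, (#|[pred x in A | f x == v]| <= k)%N) ->
  (#|A| <= k * #|V|)%N.
Proof.
move=> fV fk; rewrite -sum1_card (partition_big f [in V]) //= mulnC -sum_nat_const.
by apply: leq_sum => v _; rewrite (leq_trans _ (fk v)) // -sum1_card.
Qed.

Section Equidistribution.

Variables (L : finFieldType) (q r : nat).
Hypotheses (Lq : [pchar L].-nat q) (q_gt1 : (1 < q)%N).
Hypothesis cardL : #|L| = (q ^ r.+1)%N.

Let e := repunit q r.+1.
Let tr (x : L) := (trpoly L q r.+1).[x].
Let ker_norm := #|[pred x : L | x ^+ e == 1]|.
Let ker_tr := #|[pred y : L | tr y == 0]|.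

Lemma repunit_gt0 : (0 < e)%N.
Proof. by rewrite /e /repunit big_ord_recl. Qed.

Lemma Frobenius_trE x : tr x = \sum_(i < r.+1) x ^+ (q ^ i).
Proof. by rewrite /tr /trpoly horner_sum; apply: eq_bigr => i _; rewrite hornerXn. Qed.

Lemma Frobenius_trD x y : tr (x + y) = tr x + tr y.
Proof.
rewrite !Frobenius_trE -big_split; apply: eq_bigr => i _ /=.
by rewrite exprDn_pchar // pnatX Lq.
Qed.

Lemma Frobenius_tr_fixed x : tr x ^+ q = tr x.
Proof.
have frob (I : Type) (s : seq I) (f : I -> L) : (\sum_(i <- s) f i) ^+ q = \sum_(i <- s) f i ^+ q.
  elim: s => [|i s IHs]; first by rewrite !big_nil expr0n; case: (q) q_gt1.
  by rewrite !big_cons exprDn_pchar // IHs.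
rewrite Frobenius_trE frob big_ord_recr /= -exprM -expnSr -cardL expf_card.
rewrite [RHS]big_ord_recl expn0 expr1 addrC; congr (_ + _).
by apply: eq_bigr => i _; rewrite -exprM -expnSr.
Qed.

Lemma card_norm_fiber x : x != 0 -> #|[pred y : L | y ^+ e == x ^+ e]| = ker_norm.
Proof.
move=> x0; rewrite /ker_norm -[RHS](card_image (mulfI x0)).
apply: eq_card => y; apply/idP/imageP => [/eqP yx | [z /eqP z1 ->]].
  exists (y / x); last by rewrite mulrC divfK.
  by rewrite inE expr_div_n yx divff ?expf_neq0.
by rewrite inE exprMn z1 mulr1.
Qed.

Lemma card_tr_fiber x : #|[pred y : L | tr y == tr x]| = ker_tr.
Proof.
rewrite /ker_tr -[RHS](card_image (addrI x)).
apply: eq_card => y; apply/idP/imageP => [/eqP yx | [z /eqP z1 ->]].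
  exists (y - x); last by rewrite addrC subrK.
  by have := Frobenius_trD (y - x) x; rewrite subrK yx => /eqP; rewrite -subr_eq subrr eq_sym.
by rewrite inE Frobenius_trD z1 addr0.
Qed.

(** Norms of nonzero elements are roots of ['X^(q.-1) - 1], hence take at most [q.-1] values, and no
    fiber exceeds [ker_norm]. *)
Lemma ker_norm_ge : (#|L|.-1 <= ker_norm * q.-1)%N.
Proof.
have q1 : (0 < q.-1)%N by lia.
have := @leq_card_fibers L L (predC1 0) [pred v | v ^+ q.-1 == 1] (fun x => x ^+ e) ker_norm.
rewrite cardC1 => le; apply: (leq_trans (le _ _)).
- move=> x; rewrite !inE => x0; rewrite -exprM mulnC repunit_geom -cardL.
  apply/eqP/(mulfI x0); rewrite -exprS prednK ?expf_card ?mulr1 //.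
  exact: ltnW (finNzRing_gt1 L).
- move=> v; case: (pickP [pred x in predC1 0 | x ^+ e == v]) => [x | none].
    rewrite !inE => /andP[x0 /eqP <-]; rewrite -(card_norm_fiber x0).
    by apply/subset_leq_card/subsetP => y; rewrite !inE => /andP[].
  by rewrite eq_card0.
rewrite leq_mul2l; apply/orP; right.
have szp : size ('X^(q.-1) - 1 : {poly L})%R = q.-1.+1 by rewrite size_XnsubC.
rewrite cardE -ltnS -szp; apply: max_poly_roots.
- by rewrite -size_poly_gt0 szp.
- apply/allP => v; rewrite mem_enum inE => /eqP v1.
  by rewrite /root !hornerE v1 subrr.
- exact: enum_uniq.
Qed.

(** The same count, traces being roots of ['X^q - 'X]. *)
Lemma ker_tr_ge : (#|L| <= ker_tr * q)%N.
Proof.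
have := @leq_card_fibers L L predT [pred v | v ^+ q == v] tr ker_tr.
move=> le; apply: (leq_trans (le _ _)).
- by move=> x _; rewrite inE Frobenius_tr_fixed.
- move=> v; case: (pickP [pred x in predT | tr x == v]) => [x | none].
    rewrite !inE => /andP[_ /eqP <-]; rewrite -(card_tr_fiber x).
    by apply/subset_leq_card/subsetP => y; rewrite !inE => /andP[].
  by rewrite eq_card0.
rewrite leq_mul2l; apply/orP; right.
have szp : size ('X^q - 'X : {poly L})%R = q.+1.
  by rewrite size_polyDl ?size_polyXn // size_polyN size_polyX ltnS.
rewrite cardE -ltnS -szp; apply: max_poly_roots.
- by rewrite -size_poly_gt0 szp.
- apply/allP => v; rewrite mem_enum inE => /eqP v1.
  by rewrite /root !hornerE v1 subrr.
- exact: enum_uniq.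
Qed.

(* The characters that come, through norm and trace, from the subfield with [q]
   elements. *)
Definition factors_through (chi psi : L -> algC) :=
  (forall x y, x != 0 -> y != 0 -> x ^+ e = y ^+ e -> chi x = chi y) /\
  (forall x y, tr x = tr y -> psi x = psi y).

(** The subfield is never introduced: its elements are represented by [x ^+ e] and [tr y]. Each [z]
    other than 0 and -1 is met by [ker_norm * ker_tr] pairs, on which the characters take their
    values at [(z + 1) / z] and [z]. *)
Lemma sum_fibers chi psi : chi 0 = 0 -> factors_through chi psi ->
  \sum_(x | x != 0) \sum_y chi x * psi y * #|stepanov_fiber q r (x ^+ e) (tr y)|%:R
  = (ker_norm * ker_tr)%:R * kummer_sum chi psi.
Proof.
move=> c0 [fchi fpsi].
have fiberE x y : #|stepanov_fiber q r (x ^+ e) (tr y)|%:R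
  = \sum_z ((z != 0) && (z + 1 != 0))%:R * (x ^+ e == ((z + 1) / z) ^+ e)%:R
       * (tr y == tr z)%:R :> algC.
  rewrite -sum1_card natr_sum [LHS]big_mkcond; apply: eq_bigr => z _.
  rewrite inE /= -/e -/(tr z) -!natrM !mulnb -!andbA [_ == x ^+ e]eq_sym [tr z == _]eq_sym.
  by case: [&& _, _, _ & _].
under eq_bigr => x _ do under eq_bigr => y _ do rewrite fiberE mulr_sumr.
under eq_bigr => x _ do rewrite exchange_big.
rewrite exchange_big mulr_sumr; apply: eq_bigr => z _ /=.
have [/andP[z0 z1] | zz] := boolP ((z != 0) && (z + 1 != 0)); last first.
  rewrite big1 => [|x _]; last by rewrite big1 // => y _; rewrite !mul0r mulr0.
  rewrite (_ : (z + 1) / z = 0) ?c0 ?mul0r ?mulr0 //.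
  by apply/eqP; rewrite mulf_eq0 invr_eq0 orbC; move: zz; rewrite negb_and !negbK.
have g0 : (z + 1) / z != 0 by rewrite mulf_neq0 ?invr_neq0.
have card_natr (A : pred L) : #|A|%:R = \sum_x (A x)%:R :> algC.
  by rewrite -sum1_card natr_sum big_mkcond; apply: eq_bigr => x _; rewrite unfold_in; case: (A x).
rewrite natrM -(card_norm_fiber g0) -(card_tr_fiber z) !card_natr -mulrA mulr_suml big_mkcond.
apply: eq_bigr => x _ /=.
have [-> | x0] := eqVneq x 0.
  rewrite expr0n eqn0Ngt repunit_gt0 /= [0 == _](_ : _ = false) ?mul0r //.
  by rewrite eq_sym; apply/negbTE/expf_neq0.
case: eqP => [xg | _]; last by rewrite mul0r big1 // => y _; rewrite !(mul0r, mulr0).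
rewrite [RHS]mul1r mulr_suml; apply: eq_bigr => y _ /=.
case: eqP => [yz|_]; last by rewrite !(mul0r, mulr0).
by rewrite !(mul1r, mulr1) (fchi _ _ x0 g0 xg) (fpsi _ _ yz).
Qed.

(** An upper bound for every fiber forces equidistribution. The deficits with respect to [F] are
    nonnegative, and their total is controlled because the fibers cover all points but two. A
    nontrivial [chi] kills the constant [F], so the Kummer sum is, up to a factor [- N], a character
    sum of the deficits. *)
Lemma kummer_sum_le chi psi F : mulchar chi -> addchar psi ->
    (exists2 x, x != 0 & chi x != 1) -> factors_through chi psi ->
    (forall al be : L, (#|stepanov_fiber q r al be| <= F)%N) ->
  `|kummer_sum chi psi| + #|L|%:R <= (q.-1 * q * F)%:R + 2 :> algC.
Proof.
move=> mc ac nt ft leF.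
have [c0 _ _] := mc.
set N := (ker_norm * ker_tr)%N.
have leN : (#|L|.-1 * #|L| <= N * (q.-1 * q))%N.
  by rewrite mulnACA leq_mul ?ker_norm_ge ?ker_tr_ge.
have L_gt1 := finNzRing_gt1 L.
have N_gt0 : (0 < N)%N.
  by rewrite lt0n; apply: contraTneq leN => ->; rewrite mul0n -ltnNge muln_gt0 -subn1 subn_gt0 L_gt1 ltnW.
(* Trivial characters turn [sum_fibers] into a count of the points other than 0 and -1, which yields
   the total deficit. *)
pose one_chi (x : L) : algC := (x != 0)%:R; pose one_psi (y : L) : algC := 1.
have ft1 : factors_through one_chi one_psi.
  by split=> // x y x0 y0 _; rewrite /one_chi x0 y0.
have triv : #|L|%:R - 2 <= kummer_sum one_chi one_psi.
  rewrite -(cardC (mem [:: 0; -1 : L])) natrD lerBlDl lerD ?ler_nat //.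
    by rewrite (leq_trans (card_size _)).
  rewrite -sum1_card natr_sum big_mkcond; apply: ler_sum => z _.
  rewrite !inE negb_or mulr1 /one_chi; case: ifP => // /andP[z0 z1].
  by rewrite mulf_neq0 ?invr_neq0 // addr_eq0.
have total : \sum_(x : L | x != 0) \sum_(y : L) (F - #|stepanov_fiber q r (x ^+ e) (tr y)|)%:R
   <= N%:R * ((q.-1 * q * F)%:R - (#|L|%:R - 2)) :> algC.
  have -> : \sum_(x : L | x != 0) \sum_(y : L) (F - #|stepanov_fiber q r (x ^+ e) (tr y)|)%:R
      = (#|L|.-1 * #|L| * F)%:R - N%:R * kummer_sum one_chi one_psi :> algC.
    rewrite -sum_fibers //; last by rewrite /one_chi eqxx.
    rewrite -mulnA natrM mulr_natl -(cardC1 0) -sumr_const -sumrB.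
    apply: eq_bigr => x x0; rewrite natrM mulr_natl.
    rewrite (_ : _ *+ #|L| = \sum_(y : L) F%:R); last by rewrite sumr_const.
    rewrite -sumrB.
    apply: eq_bigr => y _; rewrite natrB //.
    by rewrite /one_chi /one_psi x0 !mul1r.
  rewrite mulrBr lerB // -?natrM ?ler_nat ?mulnA; last by rewrite ler_wpM2l.
  by rewrite leq_mul2r -mulnA leN orbT.
have main : N%:R * kummer_sum chi psi =
  - \sum_(x | x != 0) \sum_y chi x * psi y * (F - #|stepanov_fiber q r (x ^+ e) (tr y)|)%:R.
  rewrite -sum_fibers // -sumrN; apply/eqP; rewrite -subr_eq0 -sumrB.
  under eq_bigr => x _ do rewrite opprK -big_split /=.
  rewrite (eq_bigr (fun x => chi x * ((\sum_y psi y) * F%:R))) => [|x _].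
    rewrite -mulr_suml [\sum_(_ | _) _](_ : _ = 0) ?mul0r //.
    by rewrite -[RHS](sum_mulchar mc nt) [RHS](bigD1 0) //= c0 add0r.
  rewrite mulr_suml mulr_sumr; apply: eq_bigr => y _.
  by rewrite -mulrDr natrB // addrC subrK mulrA.
suff le : `|kummer_sum chi psi| <= (q.-1 * q * F)%:R - (#|L|%:R - 2).
  by move: le; rewrite opprB addrA lerBrDr.
rewrite -(@ler_pM2l _ N%:R) ?ltr0n //; apply: le_trans total.
rewrite -[N%:R in X in X <= _]normr_nat -normrM main normrN.
apply: (le_trans (ler_norm_sum _ _ _)); apply: ler_sum => x x0.
apply: (le_trans (ler_norm_sum _ _ _)); apply: ler_sum => y _.
by rewrite !normrM norm_mulchar // norm_addchar // !mul1r normr_nat.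
Qed.

End Equidistribution.

(** * Quadratic extensions *)

(** A Gauss sum times its conjugate: after [u = b * t], the sum over [b] singles out [t = 1]. *)
Lemma gauss_pair_sum (K : finFieldType) (chi psi : K -> algC) :
    mulchar chi -> addchar psi ->
    (exists2 x, x != 0 & chi x != 1) -> (exists x, psi x != 1) ->
  \sum_u \sum_b chi u * chi b^-1 * psi (u - b) = #|K|%:R.
Proof.
move=> mc ac ntc ntp; have [c0 c1 cM] := mc.
have psi_sum t : \sum_(b | b != 0) psi (b * t) = (if t == 0 then #|K|%:R else 0) - 1.
  have -> : \sum_(b | b != 0) psi (b * t) = \sum_b psi (b * t) - 1.
    by rewrite [in RHS](bigD1 0) //= mul0r (proj1 ac) addrC addrK.
  congr (_ - 1); case: eqP => [->|/eqP t0].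
    under eq_bigr => b _ do rewrite mulr0 (proj1 ac).
    by rewrite sumr_const.
  by rewrite -[RHS](sum_addchar ac ntp) [RHS](reindex_inj (mulIf t0)).
rewrite exchange_big (bigD1 0) //= [X in X + _]big1 ?add0r => [|u _]; last first.
  by rewrite invr0 c0 mulr0 mul0r.
transitivity (\sum_(b | b != 0) \sum_t chi t * psi (b * (t - 1))).
  apply: eq_bigr => b b0; rewrite (reindex_inj (mulfI b0)); apply: eq_bigr => t _ /=.
  rewrite -cM mulrBr mulr1; congr (chi _ * _).
  by rewrite mulrAC divff ?mul1r.
rewrite exchange_big /=; under eq_bigr => t _ do rewrite -mulr_sumr psi_sum mulrBr mulr1 subr_eq0.
rewrite sumrB (sum_mulchar mc ntc) subr0 (bigD1 1) //= eqxx c1 mul1r big1 ?addr0 // => t t1.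
by rewrite (negPf t1) mulr0.
Qed.

Section QuadraticExtension.

Variables (K K2 : finFieldType) (iota : {rmorphism K -> K2}).
Hypotheses (two_neq0 : 2%:R != 0 :> K) (cardK2 : #|K2| = (#|K| ^ 2)%N).

Let Q := #|K|.

Lemma ext_frobD (x y : K2) : (x + y) ^+ Q = x ^+ Q + y ^+ Q.
Proof.
have [p p_pr pK] := finPcharP K; apply: exprDn_pchar.
rewrite /Q [#|K|](card_pprimeChar pK) pnatX; apply/orP; left.
by rewrite pnatE // (fmorph_pchar iota).
Qed.

Lemma ext_frobK (x : K2) : (x ^+ Q) ^+ Q = x.
Proof. by rewrite -exprM mulnn -cardK2 expf_card. Qed.

Lemma card_exp_fiber k (v : K2) : (0 < k)%N -> (#|[pred x : K2 | x ^+ k == v]| <= k)%N.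
Proof.
move=> k0; have szp : size ('X^k - v%:P : {poly K2})%R = k.+1 by rewrite size_XnsubC.
rewrite cardE -ltnS -szp; apply: max_poly_roots.
- by rewrite -size_poly_gt0 szp.
- by apply/allP => x; rewrite mem_enum inE => /eqP xv; rewrite /root !hornerE xv subrr.
- exact: enum_uniq.
Qed.

(** The [Q] elements of the image of [iota] already exhaust the roots of ['X^Q - 'X]. *)
Lemma ext_fixed_image (y : K2) : y ^+ Q = y -> exists x, iota x = y.
Proof.
move=> yQ; have Q_gt1 : (1 < Q)%N := finNzRing_gt1 K.
have szp : size ('X^Q - 'X : {poly K2})%R = Q.+1.
  by rewrite size_polyDl ?size_polyXn // size_polyN size_polyX ltnS.
have le : (#|[pred v : K2 | v ^+ Q == v]| <= Q)%N.
  rewrite cardE -ltnS -szp; apply: max_poly_roots.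
  - by rewrite -size_poly_gt0 szp.
  - by apply/allP => v; rewrite mem_enum inE => /eqP v1; rewrite /root !hornerE v1 subrr.
  - exact: enum_uniq.
have sub : codom iota \subset [pred v : K2 | v ^+ Q == v].
  by apply/subsetP => _ /codomP[x ->]; rewrite inE -rmorphXn expf_card.
have : [pred v : K2 | v ^+ Q == v] \subset codom iota.
  by rewrite -(geq_leqif (subset_leqif_card sub)) card_codom //; apply: fmorph_inj.
by move/subsetP/(_ y); rewrite inE yQ eqxx => /(_ isT)/codomP[x ->]; exists x.
Qed.

Lemma ext_normP : exists N : K2 -> K, forall x, iota (N x) = x ^+ Q.+1.
Proof.
apply: (@fin_all_exists _ (fun=> K) (fun x a => iota a = x ^+ Q.+1)) => x.
by apply: ext_fixed_image; rewrite exprSr exprMn ext_frobK mulrC.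
Qed.

Lemma ext_traceP : exists Tr : K2 -> K, forall x, iota (Tr x) = x + x ^+ Q.
Proof.
apply: (@fin_all_exists _ (fun=> K) (fun x a => iota a = x + x ^+ Q)) => x.
by apply: ext_fixed_image; rewrite ext_frobD ext_frobK addrC.
Qed.

Variables N Tr : K2 -> K.
Hypotheses (NE : forall x, iota (N x) = x ^+ Q.+1)
  (TrE : forall x, iota (Tr x) = x + x ^+ Q).

Let iota_inj : injective iota := fmorph_inj iota.

Lemma ext_normM : {morph N : x y / x * y}.
Proof. by move=> x y; apply: iota_inj; rewrite rmorphM !NE exprMn. Qed.

Lemma ext_normV x : N x^-1 = (N x)^-1.
Proof. by apply: iota_inj; rewrite fmorphV !NE exprVn. Qed.

Lemma ext_norm0 : N 0 = 0.
Proof. by apply: iota_inj; rewrite NE rmorph0 expr0n. Qed.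

Lemma ext_norm1 : N 1 = 1.
Proof. by apply: iota_inj; rewrite NE rmorph1 expr1n. Qed.

Lemma ext_normS x : N (x + 1) = 1 + Tr x + N x.
Proof.
apply: iota_inj; rewrite !rmorphD rmorph1 !NE TrE !exprSr ext_frobD expr1n.
by ring.
Qed.

Lemma ext_traceD : {morph Tr : x y / x + y}.
Proof. by move=> x y; apply: iota_inj; rewrite rmorphD !TrE ext_frobD addrACA. Qed.

(** Fibers of the power [Q.+1] have at most [Q.+1] elements, so the [Q ^ 2 - 1] nonzero elements
    have at least [Q.-1] norms, which is all of them. *)
Lemma ext_norm_surj a : exists x, N x = a.
Proof.
have [-> | a0] := eqVneq a 0; first by exists 0; exact: ext_norm0.
have Q_gt1 : (1 < Q)%N := finNzRing_gt1 K.
have := @leq_card_fibers K2 K2 (predC1 0) (mem [set x ^+ Q.+1 | x in predC1 0])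
  (fun x => x ^+ Q.+1) Q.+1.
rewrite cardC1 cardK2 -/Q => le.
have {}le : (Q.-1 <= #|[set x ^+ Q.+1 | x : K2 in predC1 0%R]|)%N.
  have {}le : ((Q ^ 2).-1 <= Q.+1 * #|[set x ^+ Q.+1 | x : K2 in predC1 0%R]|)%N.
    apply: le => [x x0 | v]; first exact: imset_f.
    apply: leq_trans (card_exp_fiber v (ltn0Sn _)).
    by apply/subset_leq_card/subsetP => y; rewrite !inE => /andP[].
  by move: le; rewrite expnS expn1; move: #|_| => c; nia.
have sub : [set x ^+ Q.+1 | x : K2 in predC1 0] \subset [set iota b | b in predC1 0].
  apply/subsetP => _ /imsetP[x x0 ->]; rewrite -NE; apply: imset_f.
  by rewrite inE -(inj_eq iota_inj) NE rmorph0 expf_neq0.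
have : [set iota b | b in predC1 0] \subset [set x ^+ Q.+1 | x : K2 in predC1 0].
  by rewrite -(geq_leqif (subset_leqif_card sub)) card_imset // cardC1.
move/subsetP/(_ (iota a)); rewrite imset_f ?inE // => /(_ isT)/imsetP[x _ ax].
by exists x; apply: iota_inj; rewrite NE ax.
Qed.

Lemma odd_cardK : odd Q.
Proof.
have [p p_pr pK] := finPcharP K.
rewrite /Q [#|K|](card_pprimeChar pK) oddX; apply/orP; right.
have [p2 | //] := even_prime p_pr.
by case/negP: two_neq0; rewrite -p2 pcharf0.
Qed.

(** [iota a] is a power of exponent [Q.+1], which is even. *)
Lemma ext_sqrt a : exists w, w ^+ 2 = iota a.
Proof.
have [x <-] := ext_norm_surj a; exists (x ^+ Q.+1./2).
by rewrite NE -exprM muln2 -[in RHS](odd_double_half Q.+1) /= odd_cardK.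
Qed.

End QuadraticExtension.

Section KummerExtension.

Variables (K K2 : finFieldType) (iota : {rmorphism K -> K2}).
Hypotheses (two_neq0 : 2%:R != 0 :> K) (cardK2 : #|K2| = (#|K| ^ 2)%N).
Variables N Tr : K2 -> K.
Hypotheses (NE : forall x, iota (N x) = x ^+ #|K|.+1)
  (TrE : forall x, iota (Tr x) = x + x ^+ #|K|).

Let Q := #|K|.
Let iota_inj : injective iota := fmorph_inj iota.
Let two_neq0' : 2%:R != 0 :> K2.
Proof. by rewrite -(rmorph_nat iota) fmorph_eq0. Qed.

Lemma oppr_fixed (F : fieldType) (w : F) : 2%:R != 0 :> F -> w = - w -> w = 0.
Proof.
move=> two /eqP; rewrite -addr_eq0 -mulr2n -mulr_natr mulf_eq0 (negPf two) orbF.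
by move/eqP.
Qed.

(** A square root [w0] of [D] in [K2] satisfies [w0 ^+ Q = w0] or [w0 ^+ Q = - w0]; this decides
    which set contributes both roots while the other is empty. For [D = 0] each set contributes 0
    once. *)
Lemma card_sqrt_split D :
  (#|[set w : K | w ^+ 2 == D]|
   + #|[set w : K2 | (w ^+ Q == - w) && (w ^+ 2 == iota D)]| = 2)%N.
Proof.
have [w0 w0D] := ext_sqrt two_neq0 cardK2 NE D.
have frobN (w : K2) : (- w) ^+ Q = - w ^+ Q.
  by rewrite exprNn -signr_odd (odd_cardK two_neq0) expr1 mulN1r.
have [D0 | D0] := eqVneq D 0.
  rewrite D0 rmorph0 (_ : [set _ | _] = [set 0]); last first.
    by apply/setP => w; rewrite !inE expf_eq0.
  rewrite cards1 (_ : [set _ | _] = [set 0]) ?cards1 //.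
  apply/setP => w; rewrite !inE expf_eq0 /=; case: (eqVneq w 0) => [->|_]; last by rewrite andbF.
  by rewrite expr0n oppr0 eqn0Ngt (ltnW (finNzRing_gt1 K)) eqxx.
have w00 : w0 != 0.
  by apply: contraNneq D0 => w00; rewrite -(fmorph_eq0 iota) -w0D w00 expr0n.
have w0N : w0 != - w0 by apply: contraNneq w00 => /oppr_fixed->.
have sqE (w : K2) : (w ^+ 2 == iota D) = (w == w0) || (w == - w0).
  by rewrite -w0D eqf_sqr.
have : (w0 ^+ Q == w0) || (w0 ^+ Q == - w0).
  by rewrite -sqE -exprM mulnC exprM w0D -rmorphXn expf_card.
have [/eqP w0Q _ | nw0Q /= /eqP w0Q] := boolP (w0 ^+ Q == w0).
  have [v vE] := ext_fixed_image iota w0Q.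
  rewrite (_ : [set _ | _] = [set v; - v]); last first.
    apply/setP => w; rewrite !inE -(inj_eq iota_inj) rmorphXn sqE -vE -rmorphN.
    by rewrite !(inj_eq iota_inj).
  rewrite cards2 -(inj_eq iota_inj) rmorphN vE w0N.
  rewrite (_ : [set _ | _] = set0) ?cards0 //; apply/setP => w; rewrite !inE sqE.
  apply/negP => /andP[/eqP wQ /orP[/eqP we | /eqP we]]; move: wQ; rewrite we ?frobN w0Q.
    by move/eqP; rewrite (negPf w0N).
  by rewrite opprK => /esym/eqP; rewrite (negPf w0N).
rewrite (_ : [set _ | _] = set0); last first.
  apply/setP => w; rewrite !inE; apply: contraNF nw0Q => /eqP/(congr1 iota)/eqP.
  have wQ : iota w ^+ Q = iota w by rewrite -rmorphXn expf_card.
  rewrite rmorphXn sqE => /orP[] /eqP we; first by rewrite -we wQ.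
  by rewrite -[w0]opprK -we frobN wQ.
rewrite cards0 (_ : [set _ | _] = [set w0; - w0]) ?cards2 ?w0N //.
apply/setP => w; rewrite !inE sqE andbC; case: eqP => [->|_] /=; first by rewrite w0Q eqxx.
by case: eqP => [->|_] //=; rewrite frobN w0Q eqxx.
Qed.

(** Both sets are parametrised by square roots of the discriminant: [z - z'] for a pair in [K], and
    [z - z ^+ Q], which Frobenius negates, for an element of [K2]. *)
Lemma card_quadratic_split a b :
  (#|[set zz : K * K | (zz.1 + zz.2 == a)%R && (zz.1 * zz.2 == b)%R]|
   + #|[set z : K2 | (Tr z == a) && (N z == b)]| = 2)%N.
Proof.
have half (F : fieldType) (x : F) : 2%:R != 0 :> F -> x / 2%:R + x / 2%:R = x.
  by move=> two; field.
rewrite -(card_sqrt_split (a ^+ 2 - 4%:R * b)); congr (_ + _)%N.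
  rewrite -(card_imset _ (f := fun w : K => ((a + w) / 2%:R, (a - w) / 2%:R))); last first.
    by move=> w w' [e _]; apply: (addrI a); apply: (mulIf _ e); rewrite invr_eq0.
  apply: eq_card => [[z z']]; apply/idP/imsetP.
    rewrite inE /= => /andP[/eqP <- /eqP <-]; exists (z - z'); first by rewrite inE; apply/eqP; ring.
    by congr (_, _); field.
  case=> w; rewrite inE => /eqP wD [-> ->]; rewrite inE /=.
  apply/andP; split; apply/eqP; first by field.
  have -> : (a + w) / 2%:R * ((a - w) / 2%:R) = (a ^+ 2 - w ^+ 2) / 4%:R.
    by field; rewrite two_neq0 (_ : 4%:R = 2%:R * 2%:R) ?mulf_neq0 // -natrM.
  rewrite wD; field.
  by rewrite (_ : 4%:R = 2%:R * 2%:R) ?mulf_neq0 // -natrM.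
have four_neq0 : 4%:R != 0 :> K2 by rewrite (_ : 4%:R = 2%:R * 2%:R) ?mulf_neq0 // -natrM.
have fr2 : (2%:R : K2) ^+ Q = 2%:R by rewrite -(rmorph_nat iota) -rmorphXn expf_card.
have fra : iota a ^+ Q = iota a by rewrite -rmorphXn expf_card.
rewrite -[RHS](card_imset _ (f := fun w : K2 => (iota a + w) / 2%:R)); last first.
  by move=> w w' e; apply: (addrI (iota a)); apply: (mulIf _ e); rewrite invr_eq0.
apply: eq_card => z; apply/idP/imsetP.
  rewrite inE -!(inj_eq iota_inj) TrE NE => /andP[/eqP za /eqP zb].
  have zQ : z ^+ Q = iota a - z by rewrite -za addrC addKr.
  exists (z - z ^+ Q); last by rewrite zQ; field.
  rewrite inE (ext_frobD iota) exprNn -signr_odd (odd_cardK two_neq0) expr1 mulN1r ext_frobK //.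
  rewrite opprB addrC eqxx /= rmorphB rmorphXn rmorphM rmorph_nat -za -zb (exprSr z Q).
  by apply/eqP; ring.
case=> w; rewrite inE => /andP[/eqP wQ /eqP wD] ->.
rewrite inE -!(inj_eq iota_inj) TrE NE.
have zQ : ((iota a + w) / 2%:R) ^+ Q = (iota a - w) / 2%:R.
  by rewrite exprMn exprVn fr2 (ext_frobD iota) fra wQ.
rewrite exprSr zQ; apply/andP; split; apply/eqP; first by field.
have -> : (iota a - w) / 2%:R * ((iota a + w) / 2%:R) = (iota a ^+ 2 - w ^+ 2) / 4%:R.
  by field; rewrite two_neq0' four_neq0.
by rewrite wD rmorphB rmorphXn rmorphM rmorph_nat; field.
Qed.

(* The pairs of elements of [K] and the elements of [K2] with prescribed trace
   and norm are counted by the roots of the same quadratic polynomial. *)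
Lemma kummer_sum_ext chi psi : mulchar chi -> addchar psi ->
    (exists2 x, x != 0 & chi x != 1) -> (exists x, psi x != 1) ->
  kummer_sum chi psi ^+ 2 + kummer_sum (chi \o N) (psi \o Tr)
  = 2%:R * (psi (-1) * Q%:R).
Proof.
move=> mc ac ntc ntp; have [c0 c1 cM] := mc; have [p0 pD] := ac.
(* As [(z + 1) * (z' + 1) = 1 + (z + z') + z * z'], a product of two summands depends only on the
   sum and product of the points. By [ext_normS], a summand over [K2] is the same function of trace
   and norm. *)
pose lambda (ab : K * K) := chi ((1 + ab.1 + ab.2) / ab.2) * psi ab.1.
have E1 : kummer_sum chi psi ^+ 2
    = \sum_ab lambda ab * #|[set zz : K * K | (zz.1 + zz.2 == ab.1) && (zz.1 * zz.2 == ab.2)]|%:R.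
  rewrite expr2 /kummer_sum mulr_suml.
  under eq_bigr => z _ do rewrite mulr_sumr.
  rewrite pair_bigA /= (partition_big (fun zz : K * K => (zz.1 + zz.2, zz.1 * zz.2)) predT) //=.
  apply: eq_bigr => [[a b]] _ /=; rewrite -sum1_card natr_sum mulr_sumr.
  apply: eq_big => [zz | [z z'] /=]; first by rewrite inE xpair_eqE.
  rewrite xpair_eqE => /andP[/eqP <- /eqP <-]; rewrite mulr1 /lambda /= pD mulrACA -cM.
  by congr (chi _ * _); rewrite mulrACA -invfM; congr (_ / _); ring.
have E2 : kummer_sum (chi \o N) (psi \o Tr)
    = \sum_ab lambda ab * #|[set z : K2 | (Tr z == ab.1) && (N z == ab.2)]|%:R.
  rewrite /kummer_sum (partition_big (fun z => (Tr z, N z)) predT) //=.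
  apply: eq_bigr => [[a b]] _ /=; rewrite -sum1_card natr_sum mulr_sumr.
  apply: eq_big => [z | z /=]; first by rewrite inE xpair_eqE.
  rewrite xpair_eqE => /andP[/eqP <- /eqP <-]; rewrite mulr1 /lambda /=.
  by rewrite (ext_normM NE) (ext_normV NE) (ext_normS NE TrE).
rewrite E1 E2 -big_split /=.
under eq_bigr => ab _ do rewrite -mulrDr -natrD card_quadratic_split.
rewrite -mulr_suml mulrC; congr (_ * _).
rewrite -(gauss_pair_sum mc ac ntc ntp) exchange_big mulr_sumr.
transitivity (\sum_a \sum_b lambda (a, b)).
  by rewrite pair_bigA; apply: eq_bigr => [[a b]].
rewrite exchange_big; apply: eq_bigr => b _ /=; rewrite mulr_sumr.
(* With [u = 1 + a + b] in place of [a], the term becomes [psi (-1)] times that of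
   [gauss_pair_sum]. *)
rewrite (reindex_inj (addIr (- (1 + b)))); apply: eq_bigr => u _ /=.
rewrite mulrCA -pD -cM /lambda /=; congr (chi (_ / _) * psi _); by ring.
Qed.

End KummerExtension.

(** Otherwise squaring would be a bijection, although 1 and -1 have the same square. *)
Lemma nonsquare_exists (K : finFieldType) : 2%:R != 0 :> K ->
  exists d : K, forall x, x ^+ 2 != d.
Proof.
move=> two; case: (pickP (fun d : K => [forall x, x ^+ 2 != d])) => [d /forallP|sq].
  by exists d.
have surj d : exists x : K, x ^+ 2 = d.
  have /negbT := sq d; rewrite negb_forall => /existsP[x]; rewrite negbK => /eqP.
  by exists x.
have [s sE] := fin_all_exists surj.
have s_inj : injective s by move=> x y e; rewrite -(sE x) e sE.
have [t sK tK] : bijective s by apply: injF_bij.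
have tE x : t x = x ^+ 2 by rewrite -[in RHS](tK x) sE.
have /oppr_fixed /eqP : (1 : K) = - 1.
  by apply: (can_inj tK); rewrite !tE sqrrN.
by move=> /(_ two); rewrite oner_eq0.
Qed.

Lemma quadratic_extension_exists (K : finFieldType) : 2%:R != 0 :> K ->
  exists (K2 : finFieldType) (iota : {rmorphism K -> K2}), (#|K2| = #|K| ^ 2)%N.
Proof.
move=> two; have [d nsq] := nonsquare_exists two.
have szp : size ('X^2 - d%:P : {poly K})%R = 3%N by rewrite size_XnsubC.
have irr : irreducible_poly ('X^2 - d%:P).
  apply: cubic_irreducible; first by rewrite szp.
  by move=> x; rewrite /root !hornerE subr_eq0.
have [L dimL _] := irredp_FAdjoin irr.
exists (finvect_type L : finFieldType), (GRing.in_alg (finvect_type L)).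
have cardE := @card_vspace K (finvect_type L) _ fullv.
by rewrite -[2%N]/(3.-1) -szp -[X in (_ ^ X)%N]dimL -cardE card_vspacef.
Qed.

Definition nontrivial_pair (K : finFieldType) (chi psi : K -> algC) :=
  [/\ mulchar chi, addchar psi, (exists2 x, x != 0 & chi x != 1)
    & exists x, psi x != 1].

(** Compose the characters with the relative norm and trace; transitivity of norm and trace
    preserves [factors_through]. The index [r.*2.+1] encodes the doubled degree. *)
Lemma quadratic_step (K : finFieldType) (q r : nat) (chi psi : K -> algC) :
    2%:R != 0 :> K -> [pchar K].-nat q -> #|K| = (q ^ r.+1)%N ->
    nontrivial_pair chi psi -> factors_through q r chi psi ->
  exists (K2 : finFieldType) (chi2 psi2 : K2 -> algC),
  [/\ 2%:R != 0 :> K2, [pchar K2].-nat q, #|K2| = (q ^ (r.*2.+1).+1)%N,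
      nontrivial_pair chi2 psi2 & factors_through q r.*2.+1 chi2 psi2] /\
  `|kummer_sum chi psi| ^+ 2 <= 2%:R * #|K|%:R + `|kummer_sum chi2 psi2|.
Proof.
move=> two Kq cardK [mc ac ntc ntp] [fc fp].
have [K2 [iota cardK2]] := quadratic_extension_exists two.
have [N NE] := ext_normP iota cardK2; have [Tr TrE] := ext_traceP iota cardK2.
have iota_inj : injective iota := fmorph_inj iota.
have [c0 c1 cM] := mc; have [p0 pD] := ac.
have N_eq0 x : (N x == 0) = (x == 0).
  by rewrite -(fmorph_eq0 iota) NE expf_eq0.
have N1 x : x != 0 -> N x != 0 by rewrite N_eq0.
have r2 : ((r.*2.+1).+1 = r.+1 + r.+1)%N by lia.
have K2q : [pchar K2].-nat q by apply: sub_in_pnat Kq => p _; rewrite (fmorph_pchar iota).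
have normE x : x ^+ repunit q (r.*2.+1).+1 = iota (N x ^+ repunit q r.+1).
  rewrite rmorphXn NE -exprM; congr (_ ^+ _).
  rewrite /repunit r2 big_split_ord /= mulSn cardK; congr (_ + _)%N.
  by rewrite big_distrr; apply: eq_bigr => i _; rewrite expnD.
have trE x : (trpoly K2 q (r.*2.+1).+1).[x] = iota (trpoly K q r.+1).[Tr x].
  rewrite !Frobenius_trE rmorph_sum r2 big_split_ord /= -big_split.
  apply: eq_bigr => i _ /=; rewrite rmorphXn TrE exprDn_pchar; last first.
    by rewrite pnatX K2q.
  by rewrite -exprM cardK expnD.
exists K2, (chi \o N), (psi \o Tr); split; first split.
- by rewrite -(rmorph_nat iota) fmorph_eq0.
- exact: K2q.
- by rewrite cardK2 cardK -expnM; congr (_ ^ _)%N; lia.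
- split.
  + split=> [||x y] /=; first by rewrite (ext_norm0 NE).
      by rewrite (ext_norm1 NE).
    by rewrite (ext_normM NE) cM.
  + split=> [|x y] /=; last by rewrite (ext_traceD TrE) pD.
    by rewrite -p0; congr psi; apply: iota_inj; rewrite TrE !rmorph0 expr0n add0r eqn0Ngt (ltnW (finNzRing_gt1 K)).
  + case: ntc => a a0 ca; have [x xa] := ext_norm_surj two cardK2 NE a.
    by exists x; rewrite ?(=^~ N_eq0) ?xa /= ?xa.
  + case: ntp => a pa; exists (iota (a / 2%:R)) => /=.
    suff -> : Tr (iota (a / 2%:R)) = a by [].
    by apply: iota_inj; rewrite TrE -rmorphXn expf_card -rmorphD; congr (iota _); field.
- split=> x y /=.
    by move=> x0 y0; rewrite !normE => /iota_inj; apply: fc; apply: N1.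
  by rewrite !trE => /iota_inj; apply: fp.
have := kummer_sum_ext two cardK2 NE TrE mc ac ntc ntp.
move/(canRL (addrK _)) => eqn; rewrite -normrX eqn.
apply: (le_trans (ler_normB _ _)); rewrite lerD2r !normrM !normr_nat.
by rewrite (norm_addchar _ ac) mul1r.
Qed.

(** * The square-root bound *)

(** Parameters for degree [2 m]. As [M.+1 = q.-1 * q * K], comparing equations with unknowns reduces
    to [M * (K + 2 * M) < repunit q m.*2.-1]. The left side is below [3 * q ^ 4 * K ^ 2], hence
    below [q ^ 5 * K ^ 2 = q ^ (2 m - 3)]. The price is a factor [q ^ 4] over the square-root size
    [q ^ m]. *)
Lemma stepanov_parameters q m (K := (q ^ (m - 4))%N) (M := (q.-1 * q * K).-1) :
    (2 < q)%N -> (4 <= m)%N ->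
  [/\ (M <= q ^ m.*2)%N, (M * (repunit q m.*2.-1 + K + 2 * M) < q.-1 * q * K * repunit q m.*2.-1)%N
    & forall f, (f * M <= K.+1 * q ^ m.*2)%N ->
      (q.-1 * q * f <= q ^ m.*2 + 2 * q ^ (m + 4))%N].
Proof.
move=> q_gt2 m_ge4.
have K_gt0 : (0 < K)%N by rewrite expn_gt0; lia.
set w := (q.-1 * q)%N in M *.
have w_ge6 : (6 <= w)%N by rewrite /w (@leq_mul 2 3) //; lia.
have w_lt : (w < q * q)%N by rewrite /w ltn_mul2r; lia.
have Mw : M.+1 = (w * K)%N by rewrite /M prednK // muln_gt0; lia.
have wK : (w * K < q ^ 2 * K)%N by rewrite ltn_mul2r K_gt0.
have rep_ge : (q ^ 5 * K ^ 2 <= repunit q m.*2.-1)%N.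
  rewrite -expnM -expnD /repunit.
  have -> : (m.*2.-1 = (m.*2 - 2).+1)%N by lia.
  by rewrite big_ord_recr /= (leq_trans _ (leq_addl _ _)) // leq_pexp2l; lia.
have Qm : (q ^ m.*2 = K * q ^ (m + 4))%N by rewrite -expnD; congr (_ ^ _)%N; lia.
split.
- rewrite Qm; apply: (@leq_trans (q ^ 2 * K)); first lia.
  by rewrite mulnC leq_mul2l leq_pexp2l ?orbT //; lia.
- set e := repunit _ _ in rep_ge *.
  suff : (M * (K + 2 * M) < e)%N by rewrite -Mw mulSn -addnA mulnDr; lia.
  apply: leq_trans rep_ge.
  have MK : (M < q ^ 2 * K)%N by lia.
  have : (M * (K + 2 * M) < q ^ 2 * K * (3 * (q ^ 2 * K)))%N.
    have : (K <= q ^ 2 * K)%N by rewrite leq_pmull // expn_gt0; lia.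
    by move: (q ^ 2 * K)%N MK => y MK leK; apply: ltn_mul; lia.
  move/leq_trans; apply.
  have -> : (q ^ 2 * K * (3 * (q ^ 2 * K)) = 3 * (q ^ 4 * K ^ 2))%N.
    by rewrite (expnD q 2 2) !expnS !expn0; ring.
  by rewrite (expnS q 4) -mulnA leq_mul2r q_gt2 orbT.
- move=> f; rewrite Qm; set y := (q ^ (m + 4))%N => fM.
  have wK6 := leq_mul w_ge6 (leqnn K).
  have M_gt0 : (0 < M)%N by lia.
  rewrite -(leq_pmul2r M_gt0).
  have h1 : (w * f * M <= w * K.+1 * (K * y))%N by have := leq_mul (leqnn w) fM; rewrite !mulnA.
  apply: (leq_trans h1).
  have h2 : ((w + 1) * K <= 2 * M)%N by rewrite mulnDl mul1n; lia.
  have h3 := leq_mul h2 (leqnn y).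
  have -> : (w * K.+1 * (K * y) = M * (K * y) + (w + 1) * K * y)%N.
    by rewrite mulnS -Mw; ring.
  by rewrite [X in (_ <= X)%N]mulnDl leq_add //; [rewrite mulnC | rewrite [(2 * y * M)%N]mulnAC].
Qed.

Lemma kummer_sum_weak_bound (L : finFieldType) q m (chi psi : L -> algC) :
    (2 < q)%N -> (4 <= m)%N -> [pchar L].-nat q -> #|L| = (q ^ m.*2.-1.+1)%N ->
    nontrivial_pair chi psi -> factors_through q m.*2.-1 chi psi ->
  `|kummer_sum chi psi| <= (3 * q ^ (m + 4))%:R.
Proof.
move=> q_gt2 m_ge4 Lq cardL [mc ac ntc _] ft.
have [leM ltM bound] := stepanov_parameters q_gt2 m_ge4.
have mE : (m.*2.-1.+1 = m.*2)%N by lia.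
set K := (q ^ (m - 4))%N in leM ltM bound; set M := (_.-1) in leM ltM bound.
have M_gt0 : (0 < M)%N.
  have : (0 < K)%N by rewrite expn_gt0; lia.
  have : (1 * 2 <= q.-1 * q)%N by apply: leq_mul; lia.
  by rewrite /M => q2 K_gt0; have := leq_mul q2 K_gt0; lia.
pose f := (K.+1 * q ^ m.*2 %/ M)%N.
have leF (al be : L) : (#|stepanov_fiber q m.*2.-1 al be| <= f)%N.
  rewrite leq_divRL // -mE; apply: card_stepanov_fiber => //; first lia.
  by rewrite mE.
rewrite -(lerD2r #|L|%:R).
apply: le_trans (kummer_sum_le Lq (ltnW q_gt2) cardL mc ac ntc ft leF) _.
rewrite -!natrD ler_nat cardL mE.
have := bound f (leq_trunc_div _ _).
have : (2 < q ^ (m + 4))%N.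
  by apply: (leq_trans q_gt2); rewrite -{1}(expn1 q) leq_pexp2l; lia.
lia.
Qed.

(** The field and the characters are quantified existentially so that an induction can replace them
    at each quadratic extension; [s] is the square root of the cardinality. *)
Definition large_kummer_sum q r (eps : algC) :=
  exists (K : finFieldType) (chi psi : K -> algC),
  [/\ 2%:R != 0 :> K, [pchar K].-nat q, #|K| = (q ^ r.+1)%N,
      nontrivial_pair chi psi & factors_through q r chi psi] /\
  exists s : algC, [/\ 0 < s, s ^+ 2 = #|K|%:R & (2 + eps) * s <= `|kummer_sum chi psi|].

Lemma large_kummer_sum_step q r eps : 0 <= eps ->
  large_kummer_sum q r eps -> large_kummer_sum q r.*2.+1 (4%:R * eps).
Proof.
move=> eps0 [K [chi [psi [[two Kq cardK nt ft] [s [s0 s2 les]]]]]].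
have [K2 [chi2 [psi2 [[two2 K2q cardK2 nt2 ft2] le2]]]] := quadratic_step two Kq cardK nt ft.
exists K2, chi2, psi2; split => //; exists (s ^+ 2); split; first exact: exprn_gt0.
  by rewrite s2 -natrX cardK cardK2 -expnM; congr (_ ^ _)%:R; lia.
rewrite -lerBlDl -s2 in le2; apply: le_trans le2; rewrite lerBrDl.
apply: (@le_trans _ _ (((2 + eps) * s) ^+ 2)); last first.
  by rewrite ler_pXn2r // nnegrE ?mulr_ge0 ?addr_ge0 // ltW.
rewrite -mulrDl exprMn ler_wpM2r ?exprn_ge0 ?(ltW s0) // -subr_ge0.
by rewrite (_ : _ - _ = eps ^+ 2) ?exprn_ge0 //; ring.
Qed.

Lemma large_kummer_sum_iter q eps j : 0 <= eps ->
  large_kummer_sum q 0 eps -> large_kummer_sum q (2 ^ j).-1 ((4 ^ j)%:R * eps).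
Proof.
move=> eps0 base; elim: j => [|j IHj]; first by rewrite mul1r.
have -> : ((2 ^ j.+1).-1 = (2 ^ j).-1.*2.+1)%N.
  by have : (0 < 2 ^ j)%N; rewrite ?expn_gt0 // expnS; lia.
rewrite expnS natrM -mulrA; apply: large_kummer_sum_step => //.
by rewrite mulr_ge0.
Qed.

(** In degree [2 m = 2 ^ n] the lower bound [(2 + 4 ^ n * eps) * q ^ m] meets the upper bound
    [3 * q ^ 4 * q ^ m], which fails for large [n]. *)
Lemma weil_kummer_sum (K : finFieldType) (chi psi : K -> algC) :
    2%:R != 0 :> K -> nontrivial_pair chi psi ->
  `|kummer_sum chi psi| <= 2%:R * sqrtC #|K|%:R.
Proof.
move=> two nt; set q := #|K|; set s := sqrtC q%:R.
have s0 : 0 < s by rewrite sqrtC_gt0 ltr0n ltnW ?finNzRing_gt1.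
have q_gt2 : (2 < q)%N.
  have := finNzRing_gt1 K; have := odd_cardK two; rewrite -/q.
  by case: (q) => [|[|[|]]].
rewrite real_leNgt ?ger0_real ?mulr_ge0 ?(ltW s0) //; apply/negP => lt.
pose eps := `|kummer_sum chi psi| / s - 2%:R.
have eps0 : 0 < eps by rewrite subr_gt0 ltr_pdivlMr.
have base : large_kummer_sum q 0 eps.
  exists K, chi, psi; split.
    split; rewrite ?expn1 //.
      have [p p_pr pK] := finPcharP K.
      by rewrite /q [#|K|](card_pprimeChar pK) pnatX pnatE // pK.
    split=> [x y _ _|x y]; first by rewrite /repunit big_ord1 expn0 !expr1 => ->.
    by rewrite !Frobenius_trE !big_ord1 expn0 !expr1 => ->.
  exists s; split => //; first by rewrite sqrtCK.
  by rewrite /eps addrC subrK divfK // gt_eqF.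
(* The Archimedean bound makes [4 ^ n * eps] exceed [3 * q ^ 4]; adding 3 ensures [2 ^ n = 2 m] with
   [m >= 4]. *)
pose n := (Num.bound ((3 * q ^ 4)%:R / eps)).+3.
have [L [chi' [psi' [[_ Lq cardL nt' ft'] [t [t0 t2 le]]]]]] :=
  large_kummer_sum_iter n (ltW eps0) base.
have [m m_ge4 mE] : exists2 m, (4 <= m)%N & (2 ^ n = m.*2)%N.
  exists (2 ^ n.-1)%N; last by rewrite -mul2n -expnS.
  by rewrite /n /= !expnS; have : (0 < 2 ^ Num.bound ((3 * q ^ 4)%:R / eps))%N; rewrite ?expn_gt0 //; lia.
rewrite mE in cardL ft'.
have tE : t = (q ^ m)%:R.
  apply: (@pexpIrn _ 2) => //; rewrite ?nnegrE ?(ltW t0) //.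
  by rewrite t2 cardL -natrX -expnM; congr (_ ^ _)%:R; lia.
have := le_trans le (kummer_sum_weak_bound q_gt2 m_ge4 Lq cardL nt' ft').
rewrite expnD mulnCA natrM -tE mulrC ler_pM2l // => le'.
have : (4 ^ n)%:R * eps <= (3 * q ^ 4)%:R.
  by apply: le_trans le'; rewrite lerDr.
apply/negP; rewrite -real_ltNge ?realn ?ger0_real ?mulr_ge0 ?(ltW eps0) //.
rewrite -ltr_pdivrMr //; apply: lt_trans (archi_boundP _) _.
  by rewrite divr_ge0 // ltW.
rewrite ltr_nat; apply: leq_trans _ (ltnW (ltn_expl n (isT : 1 < 4)%N)).
exact: (leq_addl 2 _).
Qed.

(** * Mixing in abelian Cayley graphs *)

Section CayleyMixing.

Variable gT : finGroupType.
Hypothesis abG : abelian [set: gT].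
Let G := [set: gT]%G.

(** Fourier coefficient of a set; for the connection set of a Cayley graph, an eigenvalue. *)
Definition char_sum (S : {set gT}) (i : Iirr G) : algC := \sum_(x in S) 'chi_i x.

Lemma sum_irr_abelian x : \sum_(i : Iirr G) 'chi_i x = #|G|%:R *+ (x == 1%g).
Proof.
rewrite -cfRegE cfReg_sum sum_cfunE; apply: eq_bigr => i _.
by rewrite cfunE lin_char1 ?mul1r //; apply/char_abelianP.
Qed.

(** Expanding the squared norm gives characters at [d * b * a^-1], whose sum over all characters
    detects [d = a * b^-1]. *)
Lemma count_char_sum (S D : {set gT}) :
  (#|G| * #|[set ab in setX S S | ab.1 * ab.2^-1 \in D]%g|)%:R
  = \sum_(i : Iirr G) char_sum D i * `|char_sum S i| ^+ 2.
Proof.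
have lin (i : Iirr G) : 'chi_i \is a linear_char by apply/char_abelianP.
have termE (i : Iirr G) : char_sum D i * `|char_sum S i| ^+ 2
    = \sum_(ab in setX S S) \sum_(d in D) 'chi_i (d * (ab.2 * ab.1^-1))%g.
  rewrite normCK /char_sum rmorph_sum mulrCA mulrC -mulrA mulrC -mulrA mulr_suml.
  transitivity (\sum_(a in S) \sum_(b in S) \sum_(d in D) 'chi_i (d * (b * a^-1))%g).
    apply: eq_bigr => a _; rewrite mulr_suml mulr_sumr; apply: eq_bigr => b _.
    rewrite !mulr_sumr; apply: eq_bigr => d _.
    rewrite !lin_charM ?inE ?lin_charV_conj ?inE //.
    by rewrite mulrC [X in X * _]mulrC -mulrA.
  by rewrite pair_big; apply: eq_bigl => [[a b]]; rewrite inE.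
under [RHS]eq_bigr => i _ do rewrite termE.
rewrite exchange_big /=; under [RHS]eq_bigr => ab _ do rewrite exchange_big /=.
under [RHS]eq_bigr => ab _ do under eq_bigr => d _ do rewrite sum_irr_abelian.
have pick_term (c : algC) x : \sum_(d in D) c *+ (d == x) = c *+ (x \in D).
  rewrite big_mkcond (bigD1 x) //= eqxx big1 ?addr0 => [|d /negPf->]; by case: ifP.
rewrite natrM; move: (#|G|%:R) => c.
rewrite -sum1_card natr_sum mulr_sumr big_mkcond [RHS]big_mkcond /=.
apply: eq_bigr => [[a b]] _ /=; rewrite !inE /=.
case: ((a \in S) && (b \in S)) => //=.
rewrite (eq_bigr (fun d => c *+ (d == a * b^-1)%g)) => [|d _]; last first.
  by rewrite [in RHS]eq_mulgV1 invMg invgK.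
by rewrite pick_term; case: (_ \in D); rewrite ?mulr1.
Qed.

(** The trivial character gives the main term; the others are bounded by [B] times the Parseval
    sum. *)
Lemma cayley_mixing (S D : {set gT}) B : 0 <= B ->
    (forall i : Iirr G, i != 0 -> `|char_sum D i| <= B) ->
  (#|G| * #|[set ab in setX S S | ab.1 * ab.2^-1 \in D]%g|)%:R
  <= (#|D| * #|S| ^ 2)%:R + B * (#|G| * #|S|)%:R.
Proof.
move=> B_ge0 leB.
(* Parseval is [count_char_sum] with [D] reduced to the identity. *)
have parseval : \sum_(i : Iirr G) `|char_sum S i| ^+ 2 = (#|G| * #|S|)%:R.
  transitivity (\sum_(i : Iirr G) char_sum [set 1%g] i * `|char_sum S i| ^+ 2).
    apply: eq_bigr => i _; rewrite /char_sum big_set1 lin_char1 ?mul1r //.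
    exact/char_abelianP.
  rewrite -count_char_sum; congr (_ * _)%:R.
  rewrite -(card_imset _ (f := fun x : gT => (x, x))) => [|x y [] //].
  apply: eq_card => [[a b]]; rewrite !inE /=; apply/idP/imsetP => [|[x xS [-> ->]]].
    rewrite -eq_mulgV1 => /andP[/andP[aS _] /eqP ab]; by exists a => //; rewrite ab.
  by rewrite xS mulgV eqxx.
have sum_triv (T : {set gT}) : char_sum T 0 = #|T|%:R.
  rewrite /char_sum -sum1_card natr_sum; apply: eq_bigr => x _.
  by rewrite irr0 cfun1E inE.
have := count_char_sum S D; rewrite (bigD1 0) //= !sum_triv normr_nat -natrX -natrM => countE.
rewrite countE lerD2l; set rest := \sum_(i | _) _ in countE *.
(* The order on [algC] is partial, so [rest] must be known to be real before it is compared with its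
   norm. *)
have : rest \is Num.real.
  by rewrite -[rest](addKr (#|D| * #|S| ^ 2)%:R) -countE addrC rpredB ?realn.
move/real_ler_norm/le_trans; apply.
rewrite -parseval mulr_sumr; apply: le_trans (ler_norm_sum _ _ _) _.
rewrite [X in _ <= X](bigD1 0) //= -[X in X <= _]add0r lerD ?mulr_ge0 ?exprn_ge0 //.
apply: ler_sum => i i0; rewrite normrM [X in _ * X]ger0_norm ?exprn_ge0 //.
by rewrite ler_wpM2r ?exprn_ge0 // leB.
Qed.

End CayleyMixing.

(** If only [chi] is nontrivial, [w = z^-1] turns the sum into -1; if only [psi] is, the points 0
    and -1 are missing from a zero sum, leaving [- 1 - psi (-1)]. *)
Lemma kummer_sum_bound (K : finFieldType) (chi psi : K -> algC) :
    2%:R != 0 :> K -> mulchar chi -> addchar psi ->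
    (exists2 x, x != 0 & chi x != 1) \/ (exists x, psi x != 1) ->
  `|kummer_sum chi psi| <= 2%:R * sqrtC #|K|%:R.
Proof.
move=> two mc ac nt; have [c0 c1 cM] := mc; have [p0 pD] := ac.
have two_le : 2%:R <= 2%:R * sqrtC #|K|%:R :> algC.
  have : sqrtC 1 <= sqrtC #|K|%:R :> algC.
    by rewrite ler_sqrtC ?nnegrE ?ler01 ?ler0n // ler1n ltnW ?finNzRing_gt1.
  by rewrite sqrtC1 ler_pMr ?ltr0n.
case: (pickP (fun x => (x != 0) && (chi x != 1))) => [x /andP[x0 x1] | chi1].
  have ntc : exists2 x, x != 0 & chi x != 1 by exists x.
  case: (pickP (fun x => psi x != 1)) => [y y1 | psi1].
    by apply: weil_kummer_sum => //; split => //; exists y.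
  rewrite (_ : kummer_sum _ _ = - 1) ?normrN1 ?(le_trans _ two_le) ?(ler_nat _ 1 2) //.
  have -> : kummer_sum chi psi = \sum_(w | w != 0) chi (1 + w).
    rewrite /kummer_sum (bigD1 0) //= invr0 mulr0 c0 mul0r add0r.
    rewrite [RHS](reindex_inj (inv_inj invrK)) /=; apply: eq_big => z; rewrite ?invr_eq0 // => z0.
    by have /negbFE/eqP -> := psi1 z; rewrite mulr1 mulrDl divff // mul1r.
  have := sum_mulchar mc ntc; rewrite (reindex_inj (addrI 1)) (bigD1 0) //= addr0 c1.
  by move=> /eqP; rewrite addrC addr_eq0 => /eqP.
have {nt} ntp : exists x, psi x != 1.
  by case: nt => // [[x x0 x1]]; have := chi1 x; rewrite x0 x1.
have chiE x : x != 0 -> chi x = 1.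
  by move=> x0; have := chi1 x; rewrite x0 => /negbFE/eqP.
have -> : kummer_sum chi psi = - 1 - psi (-1).
  have N1 : (-1 : K) != 0 by rewrite oppr_eq0 oner_eq0.
  have := sum_addchar ac ntp; rewrite (bigD1 0) //= (bigD1 (-1)) //= p0 => sum0.
  rewrite /kummer_sum (bigD1 0) //= invr0 mulr0 c0 mul0r add0r.
  rewrite (bigD1 (-1)) //= addNr mul0r c0 mul0r add0r.
  rewrite (eq_bigr psi) => [|z /andP[z0 z1]]; last first.
    by rewrite chiE ?mul1r // mulf_neq0 ?invr_neq0 // addr_eq0.
  by move/eqP: sum0; rewrite addrA addrC addr_eq0 => /eqP->; rewrite opprD.
apply: le_trans (ler_normB _ _) _.
by rewrite normrN1 (norm_addchar _ ac).
Qed.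

(** * The Cayley graph on the product of the unit group and the additive group *)

Section HyperbolaGroup.

Variable F : finFieldType.
Hypothesis two : 2%:R != 0 :> F.

Let gT : finGroupType := ({unit F} * F)%type.

Lemma abelian_unit_pair : abelian [set: gT].
Proof.
apply/centsP => [[u x] _ [v y] _]; congr (_, _); last exact: addrC.
by apply: val_inj; rewrite /= mulrC.
Qed.

Let G := [set: gT]%G.

(** Since the first component is a unit and division by 0 gives 0, the second component is neither 0
    nor -1. *)
Definition kummer_graph : {set gT} := [set x : gT | val x.1 == (x.2 + 1) / x.2].

Definition unit_char (i : Iirr G) (x : F) : algC :=
  if insub x is Some u then 'chi_i ((u, 0) : gT) else 0.

Definition add_part (i : Iirr G) (z : F) : algC := 'chi_i ((1%g, z) : gT).

Let lin (i : Iirr G) : 'chi_i \is a linear_char.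
Proof. exact/(char_abelianP _ abelian_unit_pair). Qed.

Let chiM (i : Iirr G) (x y : gT) : 'chi_i (x * y)%g = 'chi_i x * 'chi_i y.
Proof. by rewrite lin_charM ?inE. Qed.

Lemma unit_pairE (u : {unit F}) (z : F) :
  ((u, z) : gT) = (((u, 0) : gT) * ((1, z) : gT))%g.
Proof. by rewrite -[u in LHS]mulg1 -[z in LHS]add0r. Qed.

Lemma unit_char_val i (u : {unit F}) : unit_char i (val u) = 'chi_i ((u, 0) : gT).
Proof. by rewrite /unit_char valK. Qed.

Lemma unit_char_mul i : mulchar (unit_char i).
Proof.
split.
- by rewrite /unit_char insubF // unitr0.
- by rewrite -[1]/(val (1%g : {unit F})) unit_char_val; exact: lin_char1.
move=> x y; rewrite /unit_char.
case: (insubP {unit F} x) => [u ux ue|nux]; last first.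
  by rewrite mul0r insubF //; apply: contraNF nux; rewrite unitrM => /andP[].
case: (insubP {unit F} y) => [v vy ve|nvy]; last first.
  by rewrite mulr0 insubF //; apply: contraNF nvy; rewrite unitrM => /andP[].
rewrite -ue -ve -[_ * _]/(val (u * v)%g) valK -chiM; congr ('chi_i _).
by rewrite -[X in (_, X) = _](addr0 (0 : F)).
Qed.

Lemma add_part_add i : addchar (add_part i).
Proof.
split; first exact: lin_char1.
by move=> x y; rewrite /add_part -chiM -[X in 'chi_i (X, x + y)](mulg1 1%g).
Qed.

(** A [z] with [(z + 1) / z] nonzero carries exactly one element of the set; for the others the
    extended character vanishes. *)
Lemma char_sum_kummer_graph (i : Iirr G) :
  char_sum kummer_graph i = kummer_sum (unit_char i) (add_part i).
Proof.
rewrite /char_sum /kummer_sum big_mkcond.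
transitivity (\sum_(u : {unit F}) \sum_(z : F)
    if ((u, z) : gT) \in kummer_graph then 'chi_i ((u, z) : gT) else 0).
  by rewrite pair_bigA; apply: eq_bigr => [[u z]].
rewrite exchange_big; apply: eq_bigr => z _ /=.
rewrite -big_mkcond /=; under eq_bigl => u do rewrite inE /=.
rewrite /unit_char; case: (insubP {unit F}) => [u0 _ ue|nu].
  rewrite (big_pred1 u0) => [|u]; last by rewrite -ue /= val_eqE.
  by rewrite /add_part -chiM unit_pairE.
rewrite mul0r big_pred0 // => u; apply: contraNF nu => /eqP <-; exact: valP.
Qed.

Lemma kummer_graph_char_sum_bound (i : Iirr G) : i != 0 ->
  `|char_sum kummer_graph i| <= 2%:R * sqrtC #|F|%:R.
Proof.
move=> i0; rewrite char_sum_kummer_graph.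
apply: kummer_sum_bound => //; [exact: unit_char_mul | exact: add_part_add |].
case: (pickP (fun x => (x != 0) && (unit_char i x != 1))) => [x /andP[x0 x1] | chi1].
  by left; exists x.
case: (pickP (fun x => add_part i x != 1)) => [y y1 | psi1]; first by right; exists y.
case/eqP: i0; apply: irr_inj; apply/cfun_inP => [[u z] _].
rewrite irr0 cfun1E inE.
have -> : ((u, z) : gT) = (((u, 0) : gT) * ((1, z) : gT))%g.
  exact: unit_pairE.
rewrite chiM -unit_char_val; have /negbFE/eqP := psi1 z; rewrite /add_part => ->.
have := chi1 (val u); rewrite -unitfE (valP u) /= => /negbFE/eqP ->.
by rewrite mulr1.
Qed.

Lemma card_kummer_graph : (#|kummer_graph| <= #|F|.-1)%N.
Proof.
rewrite -(cardC1 (0 : F)) -(card_in_imset (f := fun x : gT => x.2) (D := kummer_graph)).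
  apply/subset_leq_card/subsetP => _ /imsetP[[u z] + ->]; rewrite !inE /=.
  apply: contraTneq => ->; rewrite invr0 mulr0.
  by rewrite -unitfE; exact: (valP u).
move=> [u z] [v y]; rewrite !inE /= => /eqP ue /eqP ve zy.
by congr (_, _) => //; apply: val_inj; apply: etrans ue _; rewrite /= zy; apply: esym.
Qed.

(** The group has [#|F|.-1 * #|F|] elements and the graph at most [#|F|.-1], so this common factor
    cancels from [cayley_mixing]. *)
Lemma kummer_graph_incidence (S : {set gT}) :
  (#|F| * #|[set ab in setX S S | ab.1 * ab.2^-1 \in kummer_graph]%g|)%:R
  <= (#|S| ^ 2)%:R + 2%:R * sqrtC #|F|%:R * (#|F| * #|S|)%:R :> algC.
Proof.
have F_gt1 := finNzRing_gt1 F.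
have F1_gt0 : (0 < #|F|.-1)%N by rewrite -subn1 subn_gt0.
have cardG : #|G| = (#|F|.-1 * #|F|)%N.
  by rewrite cardsT card_prod -cardsT card_finField_unit.
have B0 : 0 <= 2%:R * sqrtC #|F|%:R :> algC by rewrite mulr_ge0 ?sqrtC_ge0.
have := cayley_mixing abelian_unit_pair S B0 kummer_graph_char_sum_bound.
rewrite cardG -!mulnA natrM => mix.
rewrite -(@ler_pM2l _ #|F|.-1%:R) ?ltr0n //; apply: le_trans mix _.
rewrite mulrDr lerD //; last by rewrite natrM mulrCA.
by rewrite -natrM ler_nat leq_mul2r card_kummer_graph orbT.
Qed.

End HyperbolaGroup.

(** * The energy of the parabola *)

Lemma card_quadratic_roots (K : fieldType) (T : finType) (f : T -> K) (A : {pred T}) (b c : K) :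
    {in A &, injective f} -> {in A, forall t, f t ^+ 2 + b * f t + c = 0} ->
  (#|A| <= 2)%N.
Proof.
move=> f_inj froot.
have szp : size ('X^2 + (b *: 'X + c%:P) : {poly K})%R = 3%N.
  rewrite size_polyDl size_polyXn // (leq_ltn_trans (size_polyD _ _)) // gtn_max.
  rewrite (leq_ltn_trans (size_scale_leq _ _)) ?size_polyX //.
  by rewrite (leq_ltn_trans (size_polyC_leq1 _)).
rewrite cardE -(size_map f) -ltnS -[3%N]szp; apply: max_poly_roots.
- by rewrite -size_poly_gt0 szp.
- apply/allP => _ /mapP[t tA ->]; rewrite mem_enum in tA.
  by rewrite /root !hornerE; apply/eqP; apply: froot.
- rewrite map_inj_in_uniq ?enum_uniq // => t t'; rewrite !mem_enum; exact: f_inj.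
Qed.

Section Energy.

Variable F : finFieldType.
Hypothesis two : 2%:R != 0 :> F.
Variable A : {set F}.

Let gT : finGroupType := ({unit F} * F)%type.

Definition parab (x : F * F) := x.1 + (x.2 - x.1) ^+ 2.

Definition parab_energy : {set (F * F) * (F * F)} :=
  [set xy in setX (setX A A) (setX A A) | parab xy.1 == parab xy.2].

(** The default unit 1 is taken only when [u = v], a case that [hyp_points] excludes. *)
Let hyp_point (u v : F) : gT := (insubd (1%g : {unit F}) (u - v), - (u + v)).

Let hyp_points : {set gT} := [set hyp_point uv.1 uv.2 | uv in setX A A & uv.1 != uv.2].

Let val_hyp_point u v : u != v -> val (hyp_point u v).1 = u - v.
Proof. by move=> uv; rewrite val_insubd unitfE subr_eq0 uv. Qed.

Lemma half_inj (u v u' v' : F) : u - v = u' - v' -> u + v = u' + v' -> u = u' /\ v = v'.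
Proof.
move=> e1 e2.
have uu : u = u'.
  apply: (mulfI two); have -> : 2%:R * u = (u - v) + (u + v) by ring.
  by rewrite e1 e2; ring.
by split=> //; move: e2; rewrite uu => /addrI.
Qed.

Let hyp_point_inj u v u' v' : u != v -> u' != v' -> hyp_point u v = hyp_point u' v' ->
  u = u' /\ v = v'.
Proof.
move=> uv uv' e; apply: half_inj.
  by rewrite -(val_hyp_point uv) -(val_hyp_point uv') e.
by apply: oppr_inj; have := congr1 snd e.
Qed.

(* With [X = u - u'], [Y = u + u'], [d = p - p'] and [s = p + p'], equality of
   the two parabola values reads [(X - d) (Y - s) = - d], i.e.
   [X / d = (z + 1) / z] for [z = s - Y]. *)
Lemma card_energy_generic :
  (#|[set xy in parab_energy | (xy.1.1 != xy.2.1) && (xy.1.2 != xy.2.2)]|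
   <= #|[set ab in setX hyp_points hyp_points | ab.1 * ab.2^-1 \in kummer_graph F]%g|)%N.
Proof.
pose f (xy : (F * F) * (F * F)) := (hyp_point xy.1.2 xy.2.2, hyp_point xy.1.1 xy.2.1).
rewrite -(card_in_imset (f := f)); last first.
  move=> [[p u] [p' u']] [[r v] [r' v']]; rewrite !inE /=.
  move=> /andP[_ /andP[pp uu]] /andP[_ /andP[rr vv]] [e1 e2 e3 e4].
  have [-> ->] := hyp_point_inj uu vv (congr2 pair e1 e2).
  by have [-> ->] := hyp_point_inj pp rr (congr2 pair e3 e4).
apply/subset_leq_card/subsetP => _ /imsetP[[[p u] [p' u']] + ->].
rewrite !inE /= => /andP[/andP[/andP[/andP[pA uA] /andP[pA' uA']] /eqP e] /andP[pp uu]].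
apply/andP; split.
  apply/andP; split; apply/imsetP; [exists (u, u') | exists (p, p')] => //.
    by rewrite !inE /= uA uA' uu.
  by rewrite !inE /= pA pA' pp.
have d0 : p - p' != 0 by rewrite subr_eq0.
have -> : (- (u + u') * (- (p + p'))^-1)%g = (p + p') - (u + u').
  by rewrite -[LHS]/(- (u + u') - (- (p + p'))) opprK addrC.
have -> : FinRing.uval (insubd (1%g : {unit F}) (u - u')) = u - u' := val_hyp_point uu.
have -> : FinRing.uval (insubd (1%g : {unit F}) (p - p')) = p - p' := val_hyp_point pp.
set z := p + p' - (u + u').
have key : (u - u' - (p - p')) * z = p - p'.
  have -> : (u - u' - (p - p')) * z = (u' - p') ^+ 2 - (u - p) ^+ 2 by rewrite /z; ring.
  have -> : (u' - p') ^+ 2 = p + (u - p) ^+ 2 - p' by move: e; rewrite /parab /= => ->; ring.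
  by ring.
have z0 : z != 0 by apply: contraNneq d0 => z0; rewrite -key z0 mulr0.
rewrite eqr_div //; apply/eqP; rewrite -[u - u'](subrK (p - p')) mulrDl key.
by ring.
Qed.

(** If [p = p'], then [u] is a root of a monic quadratic determined by [(p, u')]; if [u = u'], then
    [p] is a root of one determined by [(u, p')]. Each case gives at most [2 * #|A| ^ 2]
    quadruples. *)
Lemma card_energy_degenerate :
  (#|parab_energy :\: [set xy | (xy.1.1 != xy.2.1) && (xy.1.2 != xy.2.2)]| <= 4 * #|A| ^ 2)%N.
Proof.
have cardAA : #|setX A A| = (#|A| ^ 2)%N by rewrite cardsX mulnn.
pose E1 := [set xy in parab_energy | xy.1.1 == xy.2.1].
pose E2 := [set xy in parab_energy | xy.1.2 == xy.2.2].
have le1 : (#|E1| <= 2 * #|setX A A|)%N.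
  apply: (leq_card_fibers (f := fun xy : (F * F) * (F * F) => (xy.1.1, xy.2.2))).
    by move=> [[p u] [p' u']]; rewrite !inE /= => /andP[/andP[/andP[/andP[-> _] /andP[_ ->]]]].
  move=> [p u'].
  apply: (card_quadratic_roots (f := fun xy : (F * F) * (F * F) => xy.1.2)
            (b := - (2%:R * p)) (c := p ^+ 2 - (u' - p) ^+ 2)).
    move=> [[p1 u1] [p1' u1']] [[p2 u2] [p2' u2']]; rewrite !inE /=.
    move=> /andP[/andP[_ /eqP <-] /eqP[-> ->]] /andP[/andP[_ /eqP <-] /eqP[-> ->]] -> //.
  move=> [[p1 u1] [p1' u1']]; rewrite !inE /= /parab /=.
  move=> /andP[/andP[/andP[_ /eqP e] /eqP pp] /eqP[pe ue]].
  rewrite -pp pe ue in e; have -> : (u' - p) ^+ 2 = (u1 - p) ^+ 2 by apply: (addrI p).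
  by ring.
have le2 : (#|E2| <= 2 * #|setX A A|)%N.
  apply: (leq_card_fibers (f := fun xy : (F * F) * (F * F) => (xy.1.2, xy.2.1))).
    by move=> [[p u] [p' u']]; rewrite !inE /= => /andP[/andP[/andP[/andP[_ ->] /andP[-> _]]]].
  move=> [u p'].
  apply: (card_quadratic_roots (f := fun xy : (F * F) * (F * F) => xy.1.1)
            (b := 1 - 2%:R * u) (c := u ^+ 2 - p' - (u - p') ^+ 2)).
    move=> [[p1 u1] [p1' u1']] [[p2 u2] [p2' u2']]; rewrite !inE /=.
    move=> /andP[/andP[_ /eqP <-] /eqP[-> ->]] /andP[/andP[_ /eqP <-] /eqP[-> ->]] -> //.
  move=> [[p1 u1] [p1' u1']]; rewrite !inE /= /parab /=.
  move=> /andP[/andP[/andP[_ /eqP e] /eqP uu] /eqP[ue pe]].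
  rewrite -uu ue pe in e.
  have -> : (u - p') ^+ 2 = p1 + (u - p1) ^+ 2 - p' by rewrite e; ring.
  by ring.
rewrite -cardAA; apply: (@leq_trans (#|E1| + #|E2|)); last by lia.
apply: leq_trans _ (leq_card_setU E1 E2); apply/subset_leq_card/subsetP => xy.
by rewrite !inE => /andP[]; rewrite negb_and !negbK => /orP[] -> ->; rewrite ?orbT.
Qed.

(** The 6 is 2 from the Kummer sum bound plus 4 from the degenerate quadruples, whose count is
    multiplied by a square root that is at least 1. *)
Lemma parab_energy_le :
  (#|F| * #|parab_energy|)%:R
  <= (#|A| ^ 4)%:R + 6%:R * sqrtC #|F|%:R * (#|F| * #|A| ^ 2)%:R :> algC.
Proof.
set q := #|F|; set s := sqrtC q%:R.
have s1 : 1 <= s.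
  rewrite -sqrtC1 ler_sqrtC ?nnegrE ?ler01 ?ler0n // ler1n.
  exact: ltnW (finNzRing_gt1 F).
have s0 : 0 <= s by apply: le_trans s1.
have leS : (#|hyp_points| <= #|A| ^ 2)%N.
  apply: leq_trans (leq_imset_card _ _) _; rewrite -mulnn -cardsX.
  by apply/subset_leq_card/subsetP => x; rewrite inE => /andP[].
have leE : (#|parab_energy| <= #|[set ab in setX hyp_points hyp_points
    | ab.1 * ab.2^-1 \in kummer_graph F]%g| + 4 * #|A| ^ 2)%N.
  rewrite -(cardsID [set xy | (xy.1.1 != xy.2.1) && (xy.1.2 != xy.2.2)] parab_energy).
  rewrite leq_add ?card_energy_degenerate // (leq_trans _ card_energy_generic) //.
  by apply/subset_leq_card/subsetP => x; rewrite !inE.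
have incid := kummer_graph_incidence two hyp_points; rewrite -/q -/s in incid.
move: incid leE; set T := #|[set ab in _ | _]| => incid leE.
apply: (@le_trans _ _ (q * (T + 4 * #|A| ^ 2))%:R).
  by rewrite ler_nat leq_mul2l leE orbT.
apply: (@le_trans _ _ ((#|hyp_points| ^ 2)%:R + 2%:R * s * (q * #|hyp_points|)%:R
    + (q * (4 * #|A| ^ 2))%:R)).
  by rewrite mulnDr natrD lerD2r.
rewrite -addrA; rewrite lerD //; first by rewrite ler_nat (expnM _ 2 2) leq_exp2r.
set W := (q * #|A| ^ 2)%:R.
rewrite (_ : 6%:R * s * W = 2%:R * s * W + 4%:R * s * W); last by ring.
rewrite lerD //.
  by rewrite ler_wpM2l ?mulr_ge0 // ler_nat leq_mul2l leS orbT.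
rewrite mulnCA natrM ler_wpM2r ?ler0n // ler_peMr //.
Qed.

Lemma card_le_of_no_pattern :
    (forall x y, y != 0 -> x \in A -> x + y \in A -> x + y ^+ 2 \in A -> False) ->
  (#|A| ^ 6 <= 576 * #|F| ^ 5)%N.
Proof.
move=> none; set q := #|F|; set a := #|A|; set s : algC := sqrtC q%:R.
have s0 : 0 <= s by rewrite sqrtC_ge0 ler0n.
have q_gt1 : (1 < q)%N := finNzRing_gt1 F.
(* If [a ^ 2 < 2 * q], the bound holds since [a ^ 6 <= 8 * q ^ 3]. Otherwise [a ^ 2 - q] is at least
   half of [a ^ 2]. *)
have [a_small | a_large] := ltnP (a ^ 2) (2 * q).
  have := leq_mul (ltnW a_small) (leq_mul (ltnW a_small) (ltnW a_small)).
  rewrite -!expnD => /leq_trans; apply.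
  have : (q ^ 3 <= q ^ 5)%N by rewrite leq_pexp2l // ltnW.
  by rewrite !expnS !expn0; lia.
pose R z := #|[set x in setX A A | parab x == z]|.
have sumR : (\sum_z R z = a ^ 2)%N.
  rewrite -mulnn -cardsX -sum1_card (partition_big parab predT) //=.
  by apply: eq_bigr => z _; rewrite /R -sum1_card; apply: eq_bigl => x; rewrite inE.
have sumR2 : (\sum_z R z * R z = #|parab_energy|)%N.
  rewrite -sum1_card (partition_big (fun xy : (F * F) * (F * F) => parab xy.1) predT) //=.
  apply: eq_bigr => z _; rewrite /R -cardsX -sum1_card; apply: eq_bigl => [[x y]].
  rewrite !inE /=; case: (parab x =P z) => [<-|]; rewrite ?andbF //=.
  by rewrite !andbT [parab y == _]eq_sym !andbA.
(* A representation of [z] with [u != p] would be the pattern [x = p], [y = u - p]; only [p = u = z]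
   remains. *)
have R_le1 z : z \in A -> (R z <= 1)%N.
  move=> zA; rewrite -(cards1 (z, z)); apply/subset_leq_card/subsetP => [[p u]].
  rewrite !inE /parab /= => /andP[/andP[pA uA] /eqP e].
  have [pu | pu] := eqVneq u p.
    by move: e; rewrite pu subrr expr0n addr0 => ->.
  case: (none p (u - p)); rewrite ?subr_eq0 // ?e //.
  by rewrite addrC subrK.
have var : \sum_z ((a ^ 2)%:R - (q * R z)%:R) ^+ 2 = q%:R * ((q * #|parab_energy|)%:R - (a ^ 4)%:R) :> algC.
  pose u : algC := a%:R; pose v : algC := q%:R.
  transitivity (\sum_z (u ^+ 4 + (- (2%:R * u ^+ 2 * v) * (R z)%:R + v ^+ 2 * (R z * R z)%:R))).
    by apply: eq_bigr => z _; rewrite !natrM /u /v; ring.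
  rewrite big_split big_split /= sumr_const -!mulr_sumr -!natr_sum sumR sumR2 -/q.
  by rewrite -mulr_natr !natrM ?natrX -/u -/v; ring.
(* Keep only the terms with [z] in [A], where [q * R z <= q]. *)
have low : (a * (a ^ 2 - q) ^ 2)%:R <= \sum_z ((a ^ 2)%:R - (q * R z)%:R) ^+ 2 :> algC.
  rewrite natrM mulr_natl -sumr_const big_mkcond /=; apply: ler_sum => z _.
  have sq_ge0 : 0 <= ((a ^ 2)%:R - (q * R z)%:R) ^+ 2 :> algC.
    by rewrite real_exprn_even_ge0 // rpredB ?realn.
  case: ifP => // zA; have qR : (q * R z <= q)%N by rewrite -{2}[q]muln1 leq_mul2l R_le1 ?orbT.
  rewrite -natrB; last by lia.
  by rewrite -natrX ler_nat leq_exp2r // leq_sub2l.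
(* Here 24 is the 6 of the energy bound times the 4 lost in replacing [a ^ 2 - q] by half of
   [a ^ 2]; its square is 576. *)
have le5 : (a * a ^ 4)%:R <= 24%:R * s * (q ^ 2 * a ^ 2)%:R :> algC.
  have low4 : (a * a ^ 4)%:R <= 4%:R * (a * (a ^ 2 - q) ^ 2)%:R :> algC.
    rewrite -natrM ler_nat mulnCA leq_mul2l (expnM a 2 2) -[4%N]/(2 ^ 2)%N -expnMn.
    by rewrite leq_exp2r // orbC; apply/orP; left; lia.
  apply: (le_trans low4); rewrite (_ : 24%:R = 4%:R * 6%:R); last by rewrite -natrM.
  rewrite -!mulrA ler_pM2l ?ltr0n //; apply: (le_trans low); rewrite var.
  rewrite mulrA (_ : 6%:R * s * _ = q%:R * (6%:R * s * (q * a ^ 2)%:R)); last first.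
    by rewrite expnS expn1 -mulnA natrM mulrCA.
  by rewrite ler_pM2l ?ltr0n 1?ltnW // lerBlDl parab_energy_le.
have a_gt0 : (0 < a)%N by move: a_large; case: (a) => //; rewrite expnS mul0n; lia.
have le3 : (a ^ 3)%:R <= 24%:R * s * (q ^ 2)%:R :> algC.
  have a20 : 0 < (a ^ 2)%:R :> algC by rewrite ltr0n expn_gt0 a_gt0.
  move: le5; rewrite (_ : (a * a ^ 4 = a ^ 3 * a ^ 2)%N); last by rewrite -expnS -expnD.
  by rewrite natrM [(q ^ 2 * _)%:R]natrM mulrA ler_pM2r.
have := le3; rewrite -(@ler_pXn2r _ 2) // ?nnegrE ?mulr_ge0 //.
rewrite !exprMn /s sqrtCK -!natrX -!natrM ler_nat -!expnM => le6.
by apply: (leq_trans le6); rewrite -mulnA -expnS.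
Qed.

End Energy.

Lemma pattern_of_large_card (F : finFieldType) (A : {set F}) :
    2%N \notin [pchar F] -> (576 * #|F| ^ 5 < #|A| ^ 6)%N ->
  exists x y : F, [/\ y != 0, x \in A, x + y \in A & x + y ^+ 2 \in A].
Proof.
move=> two large; have two0 : 2%:R != 0 :> F by move: two; rewrite inE.
case: (pickP (fun xy : F * F => [&& xy.2 != 0, xy.1 \in A, xy.1 + xy.2 \in A
                                & xy.1 + xy.2 ^+ 2 \in A])) => [[x y] /and4P /= |none].
  by exists x, y.
move: large; rewrite ltnNge card_le_of_no_pattern // => x y y0 xA xyA xy2A.
by have := none (x, y); rewrite /= y0 xA xyA xy2A.
Qed.

(* Passage to real exponents *)
Local Close Scope ring_scope.

From Stdlib Require Import Reals Lra.

Lemma INR_expn (a n : nat) : INR (expn a n) = pow (INR a) n.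
Proof. by elim: n => [|n IHn] //=; rewrite expnS mult_INR IHn. Qed.

(* F : finite field with q = #|F| elements, of odd characteristic (2 is not its characteristic).
   Field operations are written with explicit GRing names since %R here denotes Stdlib's R_scope. *)
Theorem theorem1p1 :
  exists C : R, (0 < C)%R /\
    forall (F : finFieldType) (A : {set F}),
      (2%N \notin GRing.pchar F) ->
      (INR #|A| >= C * Rpower (INR #|F|) (5 / 6))%R ->
      exists x y : F, y != @GRing.zero F /\ x \in A /\ GRing.add x y \in A /\
        GRing.add x (GRing.exp y 2) \in A.
Proof.
(* The constant 3 works because [3 ^ 6 = 729] exceeds 576. *)
exists 3%R; split; first lra.
move=> F A two large.
have q_pos : (0 < INR #|F|)%R by apply: lt_0_INR; apply/ssrnat.ltP; apply: ltnW; apply: finNzRing_gt1.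
have [|x [y [y0 xA xyA xy2A]]] := @pattern_of_large_card F A two; last by exists x, y.
apply/ssrnat.ltP/INR_lt; rewrite mult_INR !INR_expn.
set r := Rpower (INR #|F|) (5 / 6) in large.
have r_pos : (0 < r)%R by apply: exp_pos.
have r6 : pow r 6 = pow (INR #|F|) 5.
  rewrite -!Rpower_pow // /r Rpower_mult; congr Rpower.
  by rewrite /=; lra.
have le6 : (pow (3 * r) 6 <= pow (INR #|A|) 6)%R by apply: pow_incr; lra.
have q5_pos : (0 < pow (INR #|F|) 5)%R by apply: pow_lt.
have -> : INR 576 = 576%R by rewrite INR_IZR_INZ.
by move: le6; rewrite Rpow_mult_distr r6; lra.
Qed.
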